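(* Let $\gamma>0$, $m>0$ and $\ell>\pi$. Then there exist constants $C,\omega>0$ depending on $\ell$ such that the equation $$u_t=-\gamma m^3\Delta_\ell(\Delta_\ell u+u)-\gamma\,\mathrm{div}_\ell\bigl((3m^2u+3mu^2+u^3)\nabla_\ell(\Delta_\ell u+u)\bigr)$$ admits a non-trivial backward solution $u\in C\bigl((-\infty,0];\dot H^4_{\mathrm{ev}}(\mathbb T^2)\bigr)\cap C^1\bigl((-\infty,0];\dot L_{2,\mathrm{ev}}(\mathbb T^2)\bigr)$ which satisfies $$\|u(t)\|_{H^4}\le C\,e^{\omega t}\qquad\text{for all }t<0.$$
   Context: $\mathbb T=\mathbb R/2\pi\mathbb Z$. For functions of $(\theta,\zeta)\in\mathbb T^2$: $\nabla_\ell v=(v_\theta,\frac{\pi}{\ell}v_\zeta)^T$, $\mathrm{div}_\ell(v_1,v_2)^T=v_{1,\theta}+\frac{\pi}{\ell}v_{2,\zeta}$, $\Delta_\ell v=v_{\theta\theta}+\frac{\pi^2}{\ell^2}v_{\zeta\zeta}$. Fourier coefficients are $v_{k,l}=\frac1{4\pi^2}\int_{\mathbb T^2}v\,e^{-ik\theta}e^{-il\zeta}\,d\theta\,d\zeta$. $\dot L_{2,\mathrm{ev}}(\mathbb T^2)$ is the space of real-valued $v\in L_2(\mathbb T^2)$ with $v_{k,l}=v_{k,-l}$ (even in $\zeta$) and $v_{0,0}=0$ (zero mean); $\dot H^s_{\mathrm{ev}}(\mathbb T^2)$ is the subspace of those with $\|v\|_{H^s}^2=\sum_{k,l}(1+k^2+l^2)^s|v_{k,l}|^2<\infty$.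 The equation arises by writing $\tilde H=m+u$ in $\tilde H_t+\gamma\,\mathrm{div}_\ell(\tilde H^3\nabla_\ell(\Delta_\ell\tilde H+\tilde H))=0$, i.e. the rimming-flow equation without gravity in a rotating reference frame. *)

(* Defs.v *)
From HB Require Import structures.
From mathcomp Require Import all_boot all_order all_algebra.
From mathcomp Require Import complex.
From mathcomp Require Import all_classical all_reals all_analysis.

Set Implicit Arguments.
Unset Strict Implicit.
Unset Printing Implicit Defensive.

Import Order.TTheory GRing.Theory Num.Theory.
Import numFieldNormedType.Exports.

Local Open Scope classical_set_scope.
Local Open Scope ring_scope.

(** Functions on the torus are [2 * pi]-periodic functions on [R * R]; elements
    of [L_2] are represented by measurable functions, up to equality almost
    everywhere. The torus carries the Lebesgue measure of its fundamental
    domain, of total mass [4 * pi ^+ 2]. *)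

(** Convertible to [R * R]; it selects the measurable structure on which
    [lebesgue_measure] is declared. *)
Definition plane (R : realType) := (measurableTypeR R * measurableTypeR R)%type.

Definition square (R : realType) : set (plane R) :=
  [set` `[0, 2 * pi]] `*` [set` `[0, 2 * pi]].

Lemma measurable_square (R : realType) : measurable (@square R).
Proof. by apply: measurableX; exact: measurable_itv. Qed.

Definition torus_measure (R : realType) : {measure set (plane R) -> \bar R} :=
  mrestr (@lebesgue_measure R \x @lebesgue_measure R)%E
    (@measurable_square R).

Definition periodic2 (R : realType) (v : R * R -> R) : Prop :=
  forall x y : R, v (x + 2 * pi, y) = v (x, y) /\ v (x, y + 2 * pi) = v (x, y).

Definition L2 (R : realType) (v : R * R -> R) : Prop :=
  periodic2 v /\ v \in Lfun (torus_measure R) 2%:E.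

Definition L2norm (R : realType) (v : R * R -> R) : \bar R :=
  'N[torus_measure R]_2%:E[EFin \o v]%E.

(** Since [v] is real-valued, the integral of [v * exp (- i (k x + l y))] has
    real part the integral of [v * cos (k x + l y)] and imaginary part minus
    the integral of [v * sin (k x + l y)]. *)
Definition fourier (R : realType) (v : R * R -> R) (k l : int) : R[i] :=
  let phase (x : R * R) := k%:~R * x.1 + l%:~R * x.2 in
  Complex
    ((4 * pi ^+ 2)^-1 *
       Rintegral (torus_measure R) setT (fun x => v x * cos (phase x)))
    (- ((4 * pi ^+ 2)^-1 *
       Rintegral (torus_measure R) setT (fun x => v x * sin (phase x)))).

Definition Hnorm (R : realType) (s : R) (v : R * R -> R) : \bar R :=
  sqrte (\esum_(p in [set: int * int])
    ((1 + p.1%:~R ^+ 2 + p.2%:~R ^+ 2) `^ s *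
       (Normc.normc (fourier v p.1 p.2)) ^+ 2)%:E).

Definition L2ev (R : realType) (v : R * R -> R) : Prop :=
  [/\ L2 v, forall k l : int, fourier v k l = fourier v k (- l) &
      fourier v 0 0 = 0].

Definition Hev (R : realType) (s : R) (v : R * R -> R) : Prop :=
  L2ev v /\ (Hnorm s v < +oo)%E.

(** [w] is the weak derivative of [v] in the direction [e], as an element of
    [L_2]. The test functions are those which are continuous with a continuous
    derivative in the direction [e]; by mollification this gives the same
    notion as smooth test functions. *)
Definition weak_deriv (R : realType) (e : R * R) (v w : R * R -> R) : Prop :=
  [/\ L2 v, L2 w &
    forall phi : R * R -> R,
      periodic2 phi -> continuous phi ->
      (forall x, derivable phi x e) -> continuous ('D_e phi) ->
      Rintegral (torus_measure R) setT (fun x => v x * 'D_e phi x) =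
      - Rintegral (torus_measure R) setT (fun x => w x * phi x)].

Definition is_dtheta (R : realType) (v w : R * R -> R) : Prop :=
  weak_deriv (1, 0) v w.

Definition is_dzeta (R : realType) (v w : R * R -> R) : Prop :=
  weak_deriv (0, 1) v w.

(** The differential operators are relations, so that no value is given to a
    derivative that does not exist in [L_2]; their results are determined up to
    equality almost everywhere. *)

Definition is_grad (R : realType) (ell : R) (v g1 g2 : R * R -> R) : Prop :=
  exists vz, [/\ is_dtheta v g1, is_dzeta v vz &
    g2 = fun x => pi / ell * vz x].

Definition is_div (R : realType) (ell : R) (g1 g2 w : R * R -> R) : Prop :=
  exists a b, [/\ is_dtheta g1 a, is_dzeta g2 b &
    w = fun x => a x + pi / ell * b x].

Definition is_laplacian (R : realType) (ell : R) (v w : R * R -> R) : Prop :=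
  exists vt vtt vz vzz,
    [/\ is_dtheta v vt, is_dtheta vt vtt, is_dzeta v vz, is_dzeta vz vzz &
      w = fun x => vtt x + pi ^+ 2 / ell ^+ 2 * vzz x].

Definition is_rhs (R : realType) (gamma m ell : R) (v w : R * R -> R) : Prop :=
  let F (x : R * R) := 3 * m ^+ 2 * v x + 3 * m * v x ^+ 2 + v x ^+ 3 in
  exists lap lap2 g1 g2 d : R * R -> R,
    let p x := lap x + v x in
    [/\ is_laplacian ell v lap,
        is_laplacian ell p lap2,
        is_grad ell p g1 g2,
        is_div ell (fun x => F x * g1 x) (fun x => F x * g2 x) d &
        {ae torus_measure R, forall x,
          w x = - gamma * m ^+ 3 * lap2 x - gamma * d x}].

Definition continuous_half_line (R : realType)
    (N : (R * R -> R) -> \bar R) (u : R -> R * R -> R) : Prop :=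
  forall t : R, t <= 0 ->
    (fun s : R => N (u s \- u t)) @ within [set s | s <= 0] (nbhs t) --> 0%E.

(** At [t = 0] this is the one-sided derivative. *)
Definition is_dt (R : realType) (u u' : R -> R * R -> R) : Prop :=
  forall t : R, t <= 0 ->
    (fun h : R => L2norm (fun x => h^-1 * (u (t + h) x - u t x) - u' t x))
      @ within [set h | t + h <= 0] (0 : R)^' --> 0%E.

Definition backward_solution (R : realType) (gamma m ell : R)
    (u : R -> R * R -> R) : Prop :=
  [/\ forall t, t <= 0 -> Hev 4 (u t),
      continuous_half_line (Hnorm 4) u &
      exists u' : R -> R * R -> R,
        [/\ forall t, t <= 0 -> L2ev (u' t),
            continuous_half_line (@L2norm R) u',
            is_dt u u' &
            forall t, t <= 0 -> is_rhs gamma m ell (u t) (u' t)]].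

Definition nontrivial (R : realType) (u : R -> R * R -> R) : Prop :=
  exists2 t : R, t <= 0 & ~ {ae torus_measure R, forall x, u t x = 0}.

(* Main.v *)
Require Import Defs.
From mathcomp Require Import all_boot all_order all_algebra.
From mathcomp Require Import complex.
From mathcomp Require Import all_classical all_reals all_analysis.
From mathcomp Require Import measurable_realfun.
From mathcomp Require Import ring lra.

Set Implicit Arguments.
Unset Strict Implicit.
Unset Printing Implicit Defensive.

Import Order.TTheory GRing.Theory Num.Theory.
Import numFieldNormedType.Exports.

Local Open Scope classical_set_scope.
Local Open Scope ring_scope.

(** The solution is sought among functions of $\zeta$ alone, as a series in powers
    of $e^{\omega t}$ (a trajectory on the unstable manifold of $0$). Put
    $\kappa = \pi / \ell < 1$. The linearization acts on $\cos(j \zeta)$ by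
    $\gamma m^3 x (1 - x)$ with $x = \kappa^2 j^2$, which is positive exactly when
    $0 < j \kappa < 1$. Choose $J$ with $J \kappa < 1 \le 2 J \kappa$
    ([exists_single_unstable_mode]) and use only the modes $\cos(k J \zeta)$: then
    $k = \pm 1$ is the only unstable one; let $\omega$ be its growth rate and
    $\lambda_k$ that of the mode $k$.

    For $u = \sum c_{n,k} e^{n \omega t} \cos(k J \zeta)$ the equation says that
    $(n \omega - \lambda_k) c_{n,k}$ is the coefficient of the nonlinearity, which
    starts in degree $n = 2$. So $c_{1,1}$ is free, and for $n \ge 2$ one has to
    divide by $n \omega - \lambda_k \ge c (1 + |k|)^4$ ([resolvent_bound]). This
    gains exactly the four derivatives that the nonlinearity loses
    ([norm_correction]), so that the weighted $\ell^1$ norms of the Picard iterates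
    stay bounded when the seed $c_{1,1}$ is small ([small_seed]).

    Iterates are kept as lists of monomials in which like terms are not
    collected. Each iterate is then contained in the next one, and boundedness of
    the norms alone implies convergence ([chain_limit]), uniformly and with six
    derivatives in $\zeta$.

    The limit is interpreted through uniform limits of trigonometric sums: weak
    derivatives pass to such limits ([weak_dzeta_uniform]), which yields the
    equation ([limit_is_rhs]). Testing weak derivatives against characters bounds
    the Fourier coefficients, hence the $H^4$ norm ([Hnorm4_le]). The weight $4^n$
    in the norms leaves room to differentiate $e^{n \omega t}$ twice, which gives
    continuity and differentiability in time; the decay rate comes from
    $n \ge 1$. Finally the seed dominates the corrections at $t = 0$, so that the
    solution is not trivial ([backward_nontrivial]). *)

(** * Measure and integration on the torus *)

(** Rational boxes form a countable base, so the product of the two Borel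
    structures contains the open sets of the plane; continuous test functions
    are therefore measurable. *)
Lemma measurable_open_plane (R : realType) (U : set (R * R)) :
  open U -> measurable (U : set (plane R)).
Proof.
move=> oU.
pose box (q : rat * rat * rat) : set (plane R) :=
  ball (ratr q.1.1 : R) (ratr q.2 : R) `*` ball (ratr q.1.2 : R) (ratr q.2 : R).
pose F q := if `[< box q `<=` U >] then box q else set0.
have -> : U = \bigcup_q F q.
  apply/seteqP; split=> [[x y] Uxy|z [q _]]; last first.
    by rewrite /F; case: asboolP => // qU /qU.
  have /nbhs_ballP[e /= e0 eU] : nbhs (x, y) U by exact: open_nbhs_nbhs.
  have [r] := rat_in_itvoo (divr_gt0 e0 (@ltr0n R 2)).
  rewrite in_itv /= => /andP[r0 re].
  have near_rat (z : R) : exists q : rat, ball (ratr q : R) (ratr r) z.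
    have [q] := @rat_in_itvoo R z (z + ratr r) (ltac:(lra)).
    rewrite in_itv /= => qI; exists q.
    by rewrite -ball_normE /= ltr_distl; lra.
  have [a xa] := near_rat x; have [b yb] := near_rat y.
  have close (c w w' : R) : ball c (ratr r) w -> ball c (ratr r) w' -> ball w e w'.
    by rewrite -!ball_normE /= !ltr_distl; lra.
  exists (a, b, r) => //; rewrite /F; case: asboolP => [_|[]]; first by split.
  move=> [x' y'] [/= ax' by']; apply: eU.
  by split; [exact: close xa ax'|exact: close yb by'].
apply: countable_bigcupT_measurable => [|q]; first exact: countableP.
rewrite /F; case: asboolP => // _.
by apply: measurableX; exact: measurable_ball.
Qed.

Lemma continuous_plane_measurable (R : realType) (f : R * R -> R) :
  continuous f -> measurable_fun setT (f : plane R -> R).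
Proof.
move=> /continuousP cf; apply: (measurability _ (RGenOpens.measurableE R)).
move=> _ [_ [a [b ->] <-]]; rewrite setTI; apply: measurable_open_plane.
exact/cf/interval_open.
Qed.

Section torus_integral.
Variable R : realType.
Local Notation mu := (torus_measure R).
Local Notation leb := (@lebesgue_measure R).
Local Notation leb2 := (leb \x leb)%E.

Lemma torus_measureE (A : set (plane R)) : A `<=` @square R -> mu A = leb2 A.
Proof. by move=> AS; rewrite /torus_measure/= /mrestr setIidl. Qed.

Lemma square_measure : leb2 (@square R) = (4 * pi ^+ 2)%:E.
Proof.
transitivity (leb `[0%R, (2 * pi)%R] * leb `[0%R, (2 * pi)%R])%E.
  by apply: product_measure1E; exact: measurable_itv.
rewrite lebesgue_measure_itv/= lte_fin mulr_gt0// ?pi_gt0//.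
rewrite -EFinB -EFinM; congr (_%:E); ring.
Qed.

Lemma torus_measureT : mu setT = (4 * pi ^+ 2)%:E.
Proof. by rewrite /torus_measure/= /mrestr setTI square_measure. Qed.

(** The complement of the square is a null set. *)
Lemma torus_integral_square (f : plane R -> \bar R) : measurable_fun setT f ->
  (\int[mu]_x f x = \int[leb2]_(x in @square R) f x)%E.
Proof.
move=> mf; have mS := @measurable_square R.
rewrite -(setUv (@square R)) integral_setU//; first last.
- by rewrite disj_set2E setICr.
- by rewrite setUv.
- exact: measurableC.
have mu0 : mu (~` @square R) = 0%E.
  by rewrite /torus_measure/= /mrestr setICl measure0.
rewrite (null_set_integral (measurableC mS) (measurable_funTS mf) mu0) adde0.
by apply: eq_measure_integral => A mA; exact: torus_measureE.
Qed.

(** Test functions are bounded on the compact square by continuity, and nothing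
    is said outside of it. *)
Definition torus_bounded (f : R * R -> R) : Prop :=
  measurable_fun setT (f : plane R -> R) /\
  exists B, forall x, @square R x -> `|f x| <= B.

Lemma continuous_torus_bounded (f : R * R -> R) :
  continuous f -> torus_bounded f.
Proof.
move=> cf; split; first exact: continuous_plane_measurable.
have cS : compact (@square R).
  by apply: compact_setX; exact: segment_compact.
have : compact (f @` @square R).
  by apply: continuous_compact => //; apply: continuous_subspaceT.
move=> /compact_bounded[B [_ fB]]; exists (B + 1) => x Sx.
by apply: fB; [rewrite ltrDl|exists x].
Qed.

Lemma torus_boundedM (f g : R * R -> R) :
  torus_bounded f -> torus_bounded g -> torus_bounded (fun x => f x * g x).
Proof.
move=> [mf [B fB]] [mg [C gC]]; split; first exact: measurable_funM.
by exists (B * C) => x Sx; rewrite normrM ler_pM ?fB ?gC.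
Qed.

Lemma torus_boundedD (f g : R * R -> R) :
  torus_bounded f -> torus_bounded g -> torus_bounded (fun x => f x + g x).
Proof.
move=> [mf [B fB]] [mg [C gC]]; split; first exact: measurable_funD.
exists (B + C) => x Sx.
by rewrite (le_trans (ler_normD _ _))// lerD ?fB ?gC.
Qed.

Lemma torus_bounded_cst (c : R) : torus_bounded (fun=> c).
Proof. by split; [exact: measurable_cst|exists `|c|]. Qed.

Lemma torus_bounded_integrable_square (f : R * R -> R) : torus_bounded f ->
  leb2.-integrable (@square R) (EFin \o f : plane R -> \bar R).
Proof.
move=> [mf [B fB]]; apply: measurable_bounded_integrable.
- exact: measurable_square.
- by have /= -> := square_measure; exact: ltry.
- exact: measurable_funTS.
exists B; split; first exact: num_real.
by move=> C BC x Sx; exact: le_trans (fB _ Sx) (ltW BC).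
Qed.

Lemma torus_bounded_integrable (f : R * R -> R) : torus_bounded f ->
  mu.-integrable setT (EFin \o f : plane R -> \bar R).
Proof.
move=> bf; have [mf _] := bf.
have mEf : measurable_fun setT (EFin \o f : plane R -> \bar R).
  exact/measurable_EFinP.
apply/integrableP; split => //; rewrite torus_integral_square.
  by have /integrableP[] := torus_bounded_integrable_square bf.
exact: measurableT_comp.
Qed.

Lemma le_torus_Rintegral (f : R * R -> R) (B : R) :
  measurable_fun setT (f : plane R -> R) ->
  (forall x, @square R x -> `|f x| <= B) ->
  `|Rintegral mu setT f| <= B * (4 * pi ^+ 2).
Proof.
move=> mf fB; have mS := @measurable_square R.
have bf : torus_bounded f by split => //; exists B.
have E : Rintegral mu setT f = Rintegral leb2 (@square R) f.
  by rewrite /Rintegral torus_integral_square//; exact/measurable_EFinP.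
have -> : B * (4 * pi ^+ 2) = \int[leb2]_(x in @square R) B.
  by rewrite (Rintegral_cst _ mS); have /= -> := square_measure.
rewrite E; apply: (le_trans (le_normr_Rintegral mS _)).
  exact: torus_bounded_integrable_square.
apply: (le_Rintegral mS).
- apply: (@torus_bounded_integrable_square (fun x => `|f x|)).
  split; first exact: measurableT_comp.
  by exists B => x Sx; rewrite normr_id fB.
- exact: (torus_bounded_integrable_square (torus_bounded_cst B)).
- by move=> x Sx; exact: fB.
Qed.

End torus_integral.

(** * Integrals of derivatives over a period *)

Section periodic_integrals.
Variable R : realType.
Local Notation mu := (torus_measure R).
Local Notation leb := (@lebesgue_measure R).
Local Notation leb2 := (leb \x leb)%E.
Local Notation I := `[0%R, (2 * pi)%R]%classic.

(** Fubini. An integration by parts in one direction happens on the sections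
    in that direction, so both orders of integration are used. *)
Lemma torus_Rintegral_eq0_snd (f : R * R -> R) : torus_bounded f ->
  (forall x, \int[leb]_(y in I) (f (x, y))%:E = 0)%E ->
  Rintegral mu setT f = 0.
Proof.
move=> bf f0; have [mf _] := bf.
rewrite /Rintegral torus_integral_square; last exact/measurable_EFinP.
rewrite integral_mkcond -integral12_prod_meas1; last first.
  rewrite -integrable_mkcond; last exact: measurable_square.
  exact: torus_bounded_integrable_square.
rewrite /fubini_F integral0_eq// => x _.
have [Ix|nIx] := pselect (I x).
  rewrite -[RHS](f0 x) [RHS]integral_mkcond; apply: eq_integral => y _.
  rewrite !patchE; case: (boolP (y \in I)) => yI; last first.
    by rewrite memNset// => -[_ /= Iy]; move/negP: yI; apply; exact: mem_set.
  by rewrite mem_set//; split => //; exact: set_mem yI.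
rewrite integral0_eq// => y _.
by rewrite patchE memNset// => -[].
Qed.

Lemma torus_Rintegral_eq0_fst (f : R * R -> R) : torus_bounded f ->
  (forall y, \int[leb]_(x in I) (f (x, y))%:E = 0)%E ->
  Rintegral mu setT f = 0.
Proof.
move=> bf f0; have [mf _] := bf.
rewrite /Rintegral torus_integral_square; last exact/measurable_EFinP.
rewrite integral_mkcond -integral21_prod_meas1; last first.
  rewrite -integrable_mkcond; last exact: measurable_square.
  exact: torus_bounded_integrable_square.
rewrite /fubini_G integral0_eq// => y _.
have [Iy|nIy] := pselect (I y).
  rewrite -[RHS](f0 y) [RHS]integral_mkcond; apply: eq_integral => x _.
  rewrite !patchE; case: (boolP (x \in I)) => xI; last first.
    by rewrite memNset// => -[/= Ix _]; move/negP: xI; apply; exact: mem_set.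
  by rewrite mem_set//; split => //; exact: set_mem xI.
rewrite integral0_eq// => x _.
by rewrite patchE memNset// => -[].
Qed.

Lemma continuous_section_snd (g : R * R -> R) (x : R) :
  continuous g -> continuous (fun y => g (x, y)).
Proof.
move=> cg y; apply: (@continuous_comp _ _ _ (fun y => (x, y)) g); last exact: cg.
exact: (@cvg_pair _ _ _ (nbhs y) _ _ _ _ _ (fun=> x) id (cvg_cst x) cvg_id).
Qed.

Lemma continuous_section_fst (g : R * R -> R) (y : R) :
  continuous g -> continuous (fun x => g (x, y)).
Proof.
move=> cg x; apply: (@continuous_comp _ _ _ (fun x => (x, y)) g); last exact: cg.
exact: (@cvg_pair _ _ _ (nbhs x) _ _ _ _ _ id (fun=> y) cvg_id (cvg_cst y)).
Qed.

(** Fundamental theorem of calculus over a period. *)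
Lemma integral_period_deriv_eq0 (F f : R -> R) :
  continuous F -> continuous f -> F (2 * pi) = F 0 ->
  (forall y : R, is_derive y (1 : R) F (f y)) ->
  (\int[leb]_(y in I) (f y)%:E = 0)%E.
Proof.
move=> cF cf perF dF; rewrite (@continuous_FTC2 _ f F).
- by rewrite perF -EFinB subrr.
- by rewrite mulr_gt0 ?pi_gt0.
- exact: continuous_subspaceT.
- split => [y _|/=|/=]; first exact: ex_derive.
  + exact/cvg_at_right_filter/cF.
  + exact/cvg_at_left_filter/cF.
- by move=> y _; rewrite derive1E; exact: derive_val.
Qed.

Lemma is_derive_section_snd (psi : R * R -> R) (x y : R) :
  derivable psi (x, y) (0, 1) ->
  is_derive y (1 : R) (fun y => psi (x, y)) ('D_(0, 1) psi (x, y)).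
Proof.
rewrite /derivable /derive.
have -> : (fun h : R => h^-1 *: ((psi \o shift (x, y)) (h *: (0, 1)) - psi (x, y)))
    = (fun h => h^-1 *: (psi (x, h *: 1 + y) - psi (x, y))).
  apply/funext => h /=; congr (_ *: (psi _ - _)).
  by congr (_, _); rewrite /= /GRing.scale/= mulr0 add0r.
by move=> dx; apply: DeriveDef.
Qed.

Lemma is_derive_section_fst (psi : R * R -> R) (x y : R) :
  derivable psi (x, y) (1, 0) ->
  is_derive x (1 : R) (fun x => psi (x, y)) ('D_(1, 0) psi (x, y)).
Proof.
rewrite /derivable /derive.
have -> : (fun h : R => h^-1 *: ((psi \o shift (x, y)) (h *: (1, 0)) - psi (x, y)))
    = (fun h => h^-1 *: (psi (h *: 1 + x, y) - psi (x, y))).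
  apply/funext => h /=; congr (_ *: (psi _ - _)).
  by congr (_, _); rewrite /= /GRing.scale/= mulr0 add0r.
by move=> dx; apply: DeriveDef.
Qed.

Lemma L2norm_le (f : R * R -> R) (B : R) :
  measurable_fun setT (f : plane R -> R) -> (forall x, `|f x| <= B) ->
  (L2norm f <= (B * (2 * pi))%:E)%E.
Proof.
move=> mf fB.
have B0 : 0 <= B by rewrite (le_trans _ (fB (0, 0))).
have bf : torus_bounded f by split => //; exists B.
have mf2 : measurable_fun setT (fun x : plane R => f x ^+ 2).
  exact: measurable_funX.
have -> : (B * (2 * pi))%:E = ((B ^+ 2 * (4 * pi ^+ 2))%:E `^ 2^-1)%E.
  rewrite poweR_EFin (_ : B ^+ 2 * (4 * pi ^+ 2) = (B * (2 * pi)) `^ 2); last first.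
    by rewrite powR_mulrn ?mulr_ge0 ?pi_ge0//; ring.
  by rewrite -powRrM mulfV// powRr1// !mulr_ge0 ?pi_ge0.
rewrite /L2norm unlock; apply: gt0_ler_poweR.
- by rewrite invr_ge0.
- by rewrite in_itv /= leey andbT; apply: integral_ge0 => x _; rewrite lee_fin powR_ge0.
- by rewrite in_itv /= leey andbT lee_fin !mulr_ge0// ?exprn_ge0// pi_ge0.
have -> : ((B ^+ 2 * (4 * pi ^+ 2))%:E = \int[mu]_(x in setT) (B ^+ 2)%:E)%E.
  by rewrite integral_cst//= torus_measureT EFinM.
rewrite (eq_integral (fun x : plane R => (f x ^+ 2)%:E)); last first.
  by move=> x _; rewrite /= powR_mulrn// -normrX ger0_norm ?sqr_ge0.
apply: ge0_le_integral => //.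
- by move=> x _; rewrite lee_fin sqr_ge0.
- exact/measurable_EFinP.
- by move=> x _; rewrite lee_fin -real_normK ?num_real// lerXn2r ?nnegrE.
Qed.

Lemma L2_bounded (f : R * R -> R) (B : R) : periodic2 f ->
  measurable_fun setT (f : plane R -> R) -> (forall x, `|f x| <= B) -> L2 f.
Proof.
move=> pf mf fB; split => //; rewrite inE; apply/andP; split.
  by rewrite inE.
rewrite inE /= /finite_norm; apply: le_lt_trans (L2norm_le mf fB) _.
exact: ltry.
Qed.

End periodic_integrals.

(** * Functions of zeta alone *)

Section zeta_profile.
Variable R : realType.
Local Notation mu := (torus_measure R).
Local Notation leb := (@lebesgue_measure R).
Local Notation I := `[0%R, (2 * pi)%R]%classic.
Implicit Types (f g : R -> R) (B : R).

Definition zeta_fun f : R * R -> R := fun x => f x.2.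

(** The bound is a parameter, so that a family of profiles with bounds tending
    to $0$ expresses uniform convergence. *)
Definition profile B f : Prop :=
  [/\ forall y, f (y + 2 * pi) = f y, measurable_fun setT f &
      forall y, `|f y| <= B].

Lemma profile_measurable B f : profile B f ->
  measurable_fun setT (zeta_fun f : plane R -> R).
Proof. by move=> [_ mf _]; apply: measurableT_comp => //; exact: measurable_snd. Qed.

Lemma profile_torus_bounded B f : profile B f -> torus_bounded (zeta_fun f).
Proof.
move=> pf; split; first exact: profile_measurable pf.
by case: pf => _ _ fB; exists B => x _; exact: fB.
Qed.

Lemma profile_L2 B f : profile B f -> L2 (zeta_fun f).
Proof.
move=> pf; have [per _ fB] := pf; apply: (@L2_bounded _ _ B).
- by move=> x y; split=> //; exact: per.
- exact: profile_measurable pf.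
- by move=> x; exact: fB.
Qed.

Lemma profile_L2norm_le B f : profile B f ->
  (L2norm (zeta_fun f) <= (B * (2 * pi))%:E)%E.
Proof.
move=> pf; have [_ _ fB] := pf; apply: L2norm_le.
  exact: profile_measurable pf.
by move=> x; exact: fB.
Qed.

Lemma profile_ge0 B f : profile B f -> 0 <= B.
Proof. by move=> [_ _ /(_ 0)]; exact: le_trans. Qed.

Lemma profile_le B C f : B <= C -> profile B f -> profile C f.
Proof. by move=> BC [pf mf fB]; split => // y; exact: le_trans (fB y) BC. Qed.

Lemma profile0 : profile 0 (fun=> 0).
Proof. by split => //; move=> y; rewrite normr0. Qed.

Lemma profileM B C f g : profile B f -> profile C g ->
  profile (B * C) (fun y => f y * g y).
Proof.
move=> [pf mf fB] [pg mg gC]; split.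
- by move=> y; rewrite pf pg.
- exact: measurable_funM.
- by move=> y; rewrite normrM ler_pM.
Qed.

Lemma profileD B C f g : profile B f -> profile C g ->
  profile (B + C) (fun y => f y + g y).
Proof.
move=> [pf mf fB] [pg mg gC]; split.
- by move=> y; rewrite pf pg.
- exact: measurable_funD.
- by move=> y; rewrite (le_trans (ler_normD _ _))// lerD.
Qed.

Lemma profileZ c B f : profile B f -> profile (`|c| * B) (fun y => c * f y).
Proof. by apply: profileM; split. Qed.

(** On a horizontal section $f$ is a constant factor, and what remains is the
    integral of a derivative over a period. *)
Lemma profile_weak_dtheta B f : profile B f ->
  is_dtheta (zeta_fun f) (fun=> 0).
Proof.
move=> pf; split; [exact: profile_L2 pf|exact: profile_L2 profile0|].
move=> phi pphi cphi dphi cD.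
have -> : Rintegral mu setT (fun x => 0 * phi x) = 0.
  under eq_Rintegral do rewrite mul0r.
  by rewrite Rintegral_cst// mul0r.
rewrite oppr0; apply: torus_Rintegral_eq0_fst.
  apply: torus_boundedM; first exact: profile_torus_bounded pf.
  exact: continuous_torus_bounded.
move=> y; apply: (@integral_period_deriv_eq0 _ (fun x => f y * phi (x, y))
  (fun x => f y * 'D_(1, 0) phi (x, y))).
- by move=> x; apply: cvgM; [exact: cvg_cst|exact: continuous_section_fst].
- move=> x; apply: cvgM; [exact: cvg_cst|].
  exact: (@continuous_section_fst _ ('D_(1, 0) phi)).
- by rewrite -[2 * pi]add0r (pphi 0 y).1.
- by move=> x; apply: is_deriveZ; exact: is_derive_section_fst.
Qed.

(** On a vertical section the two integrands add up to the derivative of the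
    periodic function $f \varphi$. *)
Lemma profile_weak_dzeta B C f g : profile B f -> profile C g ->
  continuous f -> continuous g -> (forall y : R, is_derive y (1 : R) f (g y)) ->
  is_dzeta (zeta_fun f) (zeta_fun g).
Proof.
move=> pf pg cf cg df; split; [exact: profile_L2 pf|exact: profile_L2 pg|].
move=> phi pphi cphi dphi cD.
have bf := profile_torus_bounded pf; have bg := profile_torus_bounded pg.
have bphi := continuous_torus_bounded cphi.
have bD := continuous_torus_bounded cD.
apply/eqP; rewrite -subr_eq0 opprK -RintegralD//; first last.
- exact/torus_bounded_integrable/torus_boundedM.
- exact/torus_bounded_integrable/torus_boundedM.
apply/eqP; apply: torus_Rintegral_eq0_snd.
  by apply: torus_boundedD; exact: torus_boundedM.
move=> x; apply: (@integral_period_deriv_eq0 _ (fun y => f y * phi (x, y))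
  (fun y => f y * 'D_(0, 1) phi (x, y) + g y * phi (x, y))).
- by move=> y; apply: cvgM; [exact: cf|exact: continuous_section_snd].
- move=> y; apply: cvgD; (apply: cvgM; [exact: cf || exact: cg|]).
    exact: (@continuous_section_snd _ ('D_(0, 1) phi)).
  exact: (@continuous_section_snd _ phi).
- by case: pf => per _ _; rewrite -[2 * pi]add0r per (pphi x 0).2.
- move=> y; have dy := is_derive_section_snd (dphi (x, y)).
  have := is_deriveM (df y) dy; rewrite /GRing.scale/= [_ * g y]mulrC.
  exact.
Qed.

Lemma le_profile_pairing (phi : R * R -> R) : torus_bounded phi ->
  exists2 C, 0 <= C & forall B f, profile B f ->
    `|Rintegral mu setT (fun x => zeta_fun f x * phi x)| <= B * C.
Proof.
move=> bphi; have [mphi [C phiC]] := bphi.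
have C0 : 0 <= C.
  have S0 : @square R (0, 0) by split; rewrite /= in_itv /= lexx mulr_ge0 ?pi_ge0.
  exact: le_trans (normr_ge0 _) (phiC _ S0).
exists (C * (4 * pi ^+ 2)) => [|B f pf].
  by rewrite !mulr_ge0 ?pi_ge0.
rewrite mulrA; apply: le_torus_Rintegral => [|x Sx].
  by apply: measurable_funM mphi; exact: profile_measurable pf.
by case: pf => _ _ fB; rewrite normrM ler_pM ?fB ?phiC.
Qed.

Lemma profile_approx B e f fN : profile B f -> profile e (fun y => f y - fN y) ->
  profile (B + e) fN.
Proof.
move=> pf pe; have /(profileD pf) := profileZ (-1) pe.
rewrite normrN1 mul1r; congr (profile _ _).
by apply/funext => y; ring.
Qed.

Lemma RintegralB_profile B C f g (phi : R * R -> R) :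
  profile B f -> profile C g -> torus_bounded phi ->
  Rintegral mu setT (fun x => zeta_fun (fun y => f y - g y) x * phi x) =
  Rintegral mu setT (fun x => zeta_fun f x * phi x) -
  Rintegral mu setT (fun x => zeta_fun g x * phi x).
Proof.
move=> /profile_torus_bounded bf /profile_torus_bounded bg bphi.
rewrite -RintegralB//; first last.
- exact/torus_bounded_integrable/torus_boundedM.
- exact/torus_bounded_integrable/torus_boundedM.
by congr Rintegral; apply/funext => x; rewrite /zeta_fun mulrBl.
Qed.

(** The defining identity of weak derivatives only involves integrals against
    bounded functions, so it passes to uniform limits: this is how series are
    differentiated term by term below. *)
Lemma weak_dzeta_uniform B C f g (fN gN : nat -> R -> R) (eps : nat -> R) :
  profile B f -> profile C g ->
  (forall N, is_dzeta (zeta_fun (fN N)) (zeta_fun (gN N))) ->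
  (forall N, profile (eps N) (fun y => f y - fN N y)) ->
  (forall N, profile (eps N) (fun y => g y - gN N y)) ->
  eps @ \oo --> 0 ->
  is_dzeta (zeta_fun f) (zeta_fun g).
Proof.
move=> pf pg dN fe ge eps0; split; [exact: profile_L2 pf|exact: profile_L2 pg|].
move=> phi pphi cphi dphi cD.
have bphi := continuous_torus_bounded cphi.
have bD := continuous_torus_bounded cD.
have [K1 K10 leK1] := le_profile_pairing bphi.
have [K2 K20 leK2] := le_profile_pairing bD.
apply/eqP; rewrite -subr_eq0 opprK -normr_eq0; set a := `|_|.
suff a0 : a <= 0 by rewrite eq_le a0 /a/=.
have epsK : (fun N => eps N * (K2 + K1)) @ \oo --> (0 : R).
  by rewrite -(mul0r (K2 + K1)); apply: cvgM eps0 _; exact: cvg_cst.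
have aN N : a <= eps N * (K2 + K1).
  have [_ _ /(_ phi pphi cphi dphi cD) dNphi] := dN N.
  have := leK1 _ _ (ge N); have := leK2 _ _ (fe N).
  rewrite (RintegralB_profile pf (profile_approx pf (fe N)) bD).
  rewrite (RintegralB_profile pg (profile_approx pg (ge N)) bphi).
  rewrite dNphi mulrDr => h1 h2; apply: le_trans (lerD h1 h2).
  apply: le_trans (ler_normD _ _); rewrite /a le_eqVlt; apply/orP; left.
  apply/eqP; congr (`|_|); ring.
rewrite -(cvg_lim (@Rhausdorff R) epsK); apply: limr_ge => //.
  by apply/cvg_ex; exists 0.
by apply: nearW => N; exact: aN.
Qed.
End zeta_profile.

(** * Characters as test functions *)

Section trig_tests.
Variable R : realType.
Local Notation mu := (torus_measure R).

(** Directional derivatives in the plane reduce to derivatives in one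
    variable. *)
Lemma is_derive_line (phi : R * R -> R) (e x : R * R) (d : R) :
  is_derive (0 : R) (1 : R) (fun h => phi (h *: e + x)) d ->
  derivable phi x e /\ 'D_e phi x = d.
Proof.
have E : (fun h : R => h^-1 *: ((phi \o shift x) (h *: e) - phi x)) =
  (fun h : R => h^-1 *: (((fun h => phi (h *: e + x)) \o shift 0) (h *: 1) -
     phi (0 *: e + x))).
  apply/funext => h /=; rewrite scale0r add0r addr0.
  by rewrite [h *: 1]mulr1.
move=> [dl ld]; rewrite /derivable /derive E; split; first exact: dl.
exact: ld.
Qed.

Definition phase (k l : int) (x : R * R) : R := k%:~R * x.1 + l%:~R * x.2.

Lemma phase_line k l e x h :
  phase k l (h *: e + x) = h * phase k l e + phase k l x.
Proof. by rewrite /phase /= /GRing.scale/=; ring. Qed.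

Lemma continuous_phase k l : continuous (phase k l).
Proof.
move=> x; apply: cvgD; (apply: cvgM; first exact: cvg_cst).
  exact: cvg_fst.
exact: cvg_snd.
Qed.

Lemma cosD2piz (k : int) (a : R) : cos (a + k%:~R * (2 * pi)) = cos a.
Proof.
have pos n (b : R) : cos (b + n%:R * (2 * pi)) = cos b.
  elim: n b => [|n IH] b; first by rewrite mul0r addr0.
  have -> : b + n.+1%:R * (2 * pi) = b + n%:R * (2 * pi) + pi *+ 2.
    by rewrite -natr1 -[pi *+ 2]mulr_natl; ring.
  by rewrite cosD2pi.
case: k => n; first exact: pos.
by rewrite NegzE mulrNz mulNr -[in RHS](subrK (n.+1%:R * (2 * pi)) a) pos.
Qed.

Lemma sinD2piz (k : int) (a : R) : sin (a + k%:~R * (2 * pi)) = sin a.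
Proof. by rewrite -!cosBpihalf addrAC cosD2piz. Qed.

Lemma phase_periodic k l x y :
  phase k l (x + 2 * pi, y) = phase k l (x, y) + k%:~R * (2 * pi) /\
  phase k l (x, y + 2 * pi) = phase k l (x, y) + l%:~R * (2 * pi).
Proof. by rewrite /phase /=; split; ring. Qed.

Lemma periodic2_cos_phase k l : periodic2 (fun x => cos (phase k l x)).
Proof.
move=> x y; have [-> ->] := phase_periodic k l x y.
by rewrite !cosD2piz.
Qed.

Lemma periodic2_sin_phase k l : periodic2 (fun x => sin (phase k l x)).
Proof.
move=> x y; have [-> ->] := phase_periodic k l x y.
by rewrite !sinD2piz.
Qed.

Lemma continuous_cos_phase k l : continuous (fun x => cos (phase k l x)).
Proof.
move=> x; apply: continuous_comp; first exact: continuous_phase.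
exact: continuous_cos.
Qed.

Lemma continuous_sin_phase k l : continuous (fun x => sin (phase k l x)).
Proof.
move=> x; apply: continuous_comp; first exact: continuous_phase.
exact: continuous_sin.
Qed.

Lemma is_derive_phase_line k l e x :
  is_derive (0 : R) (1 : R) (fun h => h * phase k l e + phase k l x)
    (phase k l e).
Proof. by apply: is_derive_eq; rewrite /GRing.scale/=; ring. Qed.

Lemma derive_cos_phase k l e x : derivable (fun x => cos (phase k l x)) x e /\
  'D_e (fun x => cos (phase k l x)) x = - phase k l e * sin (phase k l x).
Proof.
apply: is_derive_line.
have -> : (fun h => cos (phase k l (h *: e + x))) =
    cos \o (fun h => h * phase k l e + phase k l x).
  by apply/funext => h /=; rewrite phase_line.
have := is_derive1_comp (is_derive_cos _) (is_derive_phase_line k l e x).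
by rewrite mul0r add0r mulNr -mulrN mulrC.
Qed.

Lemma derive_sin_phase k l e x : derivable (fun x => sin (phase k l x)) x e /\
  'D_e (fun x => sin (phase k l x)) x = phase k l e * cos (phase k l x).
Proof.
apply: is_derive_line.
have -> : (fun h => sin (phase k l (h *: e + x))) =
    sin \o (fun h => h * phase k l e + phase k l x).
  by apply/funext => h /=; rewrite phase_line.
have := is_derive1_comp (is_derive_sin _) (is_derive_phase_line k l e x).
by rewrite mul0r add0r mulrC.
Qed.

(** Characters are admissible test functions, and a weak derivative tested
    against them is a multiplication by the frequency. *)
Lemma weak_deriv_trig e (v w : R * R -> R) k l :
  torus_bounded v -> weak_deriv e v w ->
  phase k l e * Rintegral mu setT (fun x => v x * sin (phase k l x)) =
    Rintegral mu setT (fun x => w x * cos (phase k l x)) /\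
  phase k l e * Rintegral mu setT (fun x => v x * cos (phase k l x)) =
    - Rintegral mu setT (fun x => w x * sin (phase k l x)).
Proof.
move=> bv [L2v L2w wd].
have iv (phi : R * R -> R) : torus_bounded phi ->
    mu.-integrable setT (EFin \o (fun x => v x * phi x) : plane R -> \bar R).
  by move=> bphi; exact/torus_bounded_integrable/torus_boundedM.
have pairing (phi chi : R * R -> R) (c : R) : periodic2 phi -> continuous phi -> continuous chi ->
    (forall x, derivable phi x e /\ 'D_e phi x = c * chi x) ->
    c * Rintegral mu setT (fun x => v x * chi x) =
    - Rintegral mu setT (fun x => w x * phi x).
  move=> pphi cphi cchi dphi.
  have DE : 'D_e phi = fun x => c * chi x.
    by apply/funext => x; rewrite (dphi x).2.
  have cD : continuous ('D_e phi).
    by rewrite DE => x; apply: cvgM; [exact: cvg_cst|exact: cchi].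
  rewrite -wd//; last by move=> x; exact: (dphi x).1.
  rewrite -RintegralZl//; last exact/iv/continuous_torus_bounded.
  congr Rintegral; apply/funext => x; rewrite mulrCA; congr (_ * _); exact: esym (dphi x).2.
split.
- apply: oppr_inj; rewrite -mulNr; apply: pairing.
  + exact: periodic2_cos_phase.
  + exact: continuous_cos_phase.
  + exact: continuous_sin_phase.
  + by move=> x; exact: derive_cos_phase.
- apply: pairing.
  + exact: periodic2_sin_phase.
  + exact: continuous_sin_phase.
  + exact: continuous_cos_phase.
  + by move=> x; exact: derive_sin_phase.
Qed.

End trig_tests.

(** * Sobolev norms of functions of zeta *)

Section zeta_fourier.
Variable R : realType.
Local Notation mu := (torus_measure R).
Implicit Types (f g h : R -> R) (B : R).

Definition cos_int f k l := Rintegral mu setT (fun x => zeta_fun f x * cos (phase k l x)).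
Definition sin_int f k l := Rintegral mu setT (fun x => zeta_fun f x * sin (phase k l x)).

Lemma fourierE f k l : fourier (zeta_fun f) k l =
  Complex ((4 * pi ^+ 2)^-1 * cos_int f k l) (- ((4 * pi ^+ 2)^-1 * sin_int f k l)).
Proof. by []. Qed.

(** The weak derivative in $\theta$ is $0$, hence so is $k$ times the
    coefficient. *)
Lemma fourier_theta_eq0 B f k l : profile B f -> k != 0 ->
  fourier (zeta_fun f) k l = 0.
Proof.
move=> pf k0; have := weak_deriv_trig k l (profile_torus_bounded pf)
  (profile_weak_dtheta pf).
have kR : k%:~R != 0 :> R by rewrite intr_eq0.
have -> : phase k l ((1, 0) : R * R) = k%:~R by rewrite /phase/=; ring.
have int0 (phi : R * R -> R) : Rintegral mu setT (fun x => 0 * phi x) = 0.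
  under eq_Rintegral do rewrite mul0r.
  by rewrite Rintegral_cst// mul0r.
rewrite !int0 oppr0 => -[/eqP S0 /eqP C0].
rewrite fourierE /cos_int /sin_int.
move: S0 C0; rewrite !mulf_eq0 (negbTE kR)/= => /eqP -> /eqP ->.
by rewrite !mulr0 oppr0.
Qed.

(** Derivatives are taken two at a time: each such step multiplies both the
    cosine and the sine integrals by $- l^2$ without exchanging them. *)
Definition zeta_deriv2 f g := exists B h,
  [/\ profile B h, is_dzeta (zeta_fun f) (zeta_fun h) &
      is_dzeta (zeta_fun h) (zeta_fun g)].

Lemma trig_int_deriv2 B f g l : profile B f -> zeta_deriv2 f g ->
  l%:~R ^+ 2 * cos_int f 0 l = - cos_int g 0 l /\
  l%:~R ^+ 2 * sin_int f 0 l = - sin_int g 0 l.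
Proof.
move=> pf [C [h [ph df dh]]].
have := weak_deriv_trig 0 l (profile_torus_bounded pf) df.
have := weak_deriv_trig 0 l (profile_torus_bounded ph) dh.
have -> : phase 0 l ((0, 1) : R * R) = l%:~R by rewrite /phase/=; ring.
rewrite -/(cos_int h 0 l) -/(sin_int h 0 l) -/(cos_int f 0 l) -/(sin_int f 0 l).
rewrite -/(cos_int g 0 l) -/(sin_int g 0 l) => -[h1 h2] [h3 h4].
by rewrite !expr2 -!mulrA h4 h3 mulrN h1 h2.
Qed.

Lemma profile_fourier_sqr_le B f k l : profile B f ->
  Normc.normc (fourier (zeta_fun f) k l) ^+ 2 <= 2 * B ^+ 2.
Proof.
move=> pf; have B0 := profile_ge0 pf.
have pi2 : 0 < 4 * pi ^+ 2 :> R by rewrite mulr_gt0// exprn_gt0// pi_gt0.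
have le_int (phi : R * R -> R) : continuous phi -> (forall x, `|phi x| <= 1) ->
    ((4 * pi ^+ 2)^-1 * Rintegral mu setT (fun x => zeta_fun f x * phi x)) ^+ 2
    <= B ^+ 2.
  move=> cphi phi1; rewrite -real_normK ?num_real// lerXn2r ?nnegrE//.
  rewrite normrM ger0_norm ?invr_ge0 ?(ltW pi2)// mulrC ler_pdivrMr//.
  apply: le_torus_Rintegral => [|x _].
    apply: measurable_funM; first exact: profile_measurable pf.
    exact: continuous_plane_measurable.
  case: pf => _ _ fB; rewrite normrM -[B]mulr1 ler_pM//; exact: fB.
have -> : 2 * B ^+ 2 = B ^+ 2 + B ^+ 2 by ring.
rewrite fourierE /= sqr_sqrtr ?addr_ge0 ?sqr_ge0// sqrrN.
apply: lerD; apply: le_int.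
- exact: continuous_cos_phase.
- by move=> x; exact: cos_max.
- exact: continuous_sin_phase.
- by move=> x; exact: sin_max.
Qed.

Lemma fourier_deriv6 B f0 f2 f4 f6 l : profile B f0 -> profile B f2 ->
  profile B f4 ->
  zeta_deriv2 f0 f2 -> zeta_deriv2 f2 f4 -> zeta_deriv2 f4 f6 ->
  l%:~R ^+ 12 * Normc.normc (fourier (zeta_fun f0) 0 l) ^+ 2 =
  Normc.normc (fourier (zeta_fun f6) 0 l) ^+ 2.
Proof.
move=> p0 p2 p4 /(trig_int_deriv2 l p0)[c0 s0] /(trig_int_deriv2 l p2)[c2 s2].
move=> /(trig_int_deriv2 l p4)[c4 s4].
rewrite !fourierE /= !sqr_sqrtr ?addr_ge0 ?sqr_ge0//.
have c6 : cos_int f6 0 l = - (l%:~R ^+ 6 * cos_int f0 0 l).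
  by rewrite -[cos_int f6 _ _]opprK -c4 -[cos_int f4 _ _]opprK -c2
    -[cos_int f2 _ _]opprK -c0; ring.
have s6 : sin_int f6 0 l = - (l%:~R ^+ 6 * sin_int f0 0 l).
  by rewrite -[sin_int f6 _ _]opprK -s4 -[sin_int f4 _ _]opprK -s2
    -[sin_int f2 _ _]opprK -s0; ring.
by rewrite c6 s6; ring.
Qed.

(** The terms are bounded by $2/(i+1) - 2/(i+2)$, which telescopes. *)
Lemma sum_inv_sqr_le n :
  \sum_(0 <= i < n) (i.+1%:R ^+ 2)^-1 <= 2 - 2 / n.+1%:R :> R.
Proof.
elim: n => [|n IH]; first by rewrite big_geq// divr1 subrr.
rewrite big_nat_recr//=; apply: le_trans (lerD IH (lexx _)) _.
have n0 : 0 <= n%:R :> R by [].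
rewrite -[n.+2%:R]natr1 -[n.+1%:R]natr1.
have a0 : n%:R + 1 != 0 :> R by rewrite gt_eqF ?ltr_wpDl.
have b0 : n%:R + 1 + 1 != 0 :> R by rewrite gt_eqF ?ltr_wpDl ?ltr_wpDr.
rewrite -subr_ge0 (_ : _ - _ = n%:R / ((n%:R + 1) ^+ 2 * (n%:R + 1 + 1))); last first.
  by field; rewrite a0 b0.
by rewrite divr_ge0 ?mulr_ge0 ?sqr_ge0// !addr_ge0.
Qed.

Lemma esum_int_inv_sqr_le (M : R) : 0 <= M ->
  (\esum_(p in [set: int * int])
    (if (p.1 == 0) && (p.2 != 0) then M / p.2%:~R ^+ 2 else 0)%:E
   <= (4 * M)%:E)%E.
Proof.
move=> M0.
set c := fun p : int * int => (if _ then _ else _ : R)%:E.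
have c0 p : (0 <= c p)%E.
  by rewrite /c lee_fin; case: ifP => // _; rewrite divr_ge0// sqr_ge0.
(* The two half-lines of nonzero integers, according to the sign [s]. *)
pose e s (n : nat) : int * int := (0, if s then n.+1%:Z else - n.+1%:Z).
pose a s p := if p \in e s @` setT then c p else 0%E.
have a0 s p : (0 <= a s p)%E by rewrite /a; case: ifP.
have ca p : c p = (a true p + a false p)%E.
  have mem_e s : (p \in e s @` setT) =
      (p.1 == 0) && (if s then 0 < p.2 else p.2 < 0).
    case: p => [k l]; apply/idP/idP => [/set_mem[n _ [<- <-]]|].
      by rewrite eqxx; case: s => //=; rewrite oppr_lt0.
    move=> /andP[/= /eqP -> ls]; apply/mem_set.
    have l0 : l != 0 by move: ls; case: (s); case: ltgtP.
    exists (`|l|.-1)%N => //; congr (_, _); rewrite prednK ?absz_gt0//.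
    by case: (s) ls => ?; [rewrite gtz0_abs|rewrite ltz0_abs ?opprK].
  rewrite /a !mem_e /c; case: p {mem_e} => [k l] /=.
  case: (eqVneq k 0) => [k0|//]; rewrite ?adde0//=.
  by case: (ltgtP l 0) => //= _; rewrite ?adde0 ?add0e.
have ea s : (\esum_(p in [set: int * int]) a s p <= (2 * M)%:E)%E.
  rewrite -esum_mkcond esum_image; last first.
    by move=> i j _ _ []; case: s => [[]|/oppr_inj[]].
  rewrite -nneseries_esumT; last by move=> n; exact: c0.
  apply: lime_le.
    by apply: is_cvg_nneseries => n _ _; exact: c0.
  apply: nearW => n.
  rewrite (eq_bigr (fun i : nat => (M * (i.+1%:R ^+ 2)^-1)%:E)); last first.
    move=> i _; rewrite /c /e /=.
    by case: s; rewrite ?oppr_eq0 //= ?mulrNz ?sqrrN.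
  rewrite sumEFin lee_fin -mulr_sumr mulrC ler_wpM2r//.
  apply: le_trans (sum_inv_sqr_le n) _.
  by rewrite gerBl divr_ge0.
rewrite (eq_esum (fun p _ => ca p)) esumD//.
apply: le_trans (leeD (ea true) (ea false)) _.
by rewrite -EFinD lee_fin; lra.
Qed.

(** Six bounded derivatives make the squared Fourier coefficients decay like
    $l^{-12}$, against a weight of order $l^8$ in the squared $H^4$ norm. *)
Lemma Hnorm4_le B f0 f2 f4 f6 :
  profile B f0 -> profile B f2 -> profile B f4 -> profile B f6 ->
  zeta_deriv2 f0 f2 -> zeta_deriv2 f2 f4 -> zeta_deriv2 f4 f6 ->
  fourier (zeta_fun f0) 0 0 = 0 ->
  (Hnorm 4 (zeta_fun f0) <= (12 * B)%:E)%E.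
Proof.
move=> p0 p2 p4 p6 d0 d2 d4 mean0.
have B0 := profile_ge0 p0.
have -> : ((12 * B)%:E = sqrte ((12 * B) ^+ 2)%:E)%E.
  by rewrite /= sqrtr_sqr ger0_norm ?mulr_ge0.
rewrite /Hnorm lee_sqrt ?lee_fin ?sqr_ge0//.
apply: le_trans (_ : _ <= (4 * (32 * B ^+ 2))%:E)%E _; last first.
  by rewrite lee_fin exprMn mulrA ler_wpM2r ?sqr_ge0// -natrX -natrM ler_nat.
apply: le_trans (esum_int_inv_sqr_le _); last by rewrite mulr_ge0 ?sqr_ge0.
apply: le_esum => -[k l] _; rewrite lee_fin.
suff : (1 + k%:~R ^+ 2 + l%:~R ^+ 2) `^ 4 *
    Normc.normc (fourier (zeta_fun f0) k l) ^+ 2 <=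
    if (k == 0) && (l != 0) then 32 * B ^+ 2 / l%:~R ^+ 2 else 0 by [].
have normc0 : Normc.normc (0 : R[i]) = 0 by rewrite /= expr0n addr0 sqrtr0.
have [->|k0] := eqVneq k 0; last first.
  by rewrite (fourier_theta_eq0 l p0 k0) normc0 expr0n mulr0.
have [->|l0] := eqVneq l 0; first by rewrite mean0 normc0 expr0n mulr0.
rewrite expr0n addr0 powR_mulrn ?addr_ge0 ?sqr_ge0//.
have := fourier_deriv6 l p0 p2 p4 d0 d2 d4.
have := profile_fourier_sqr_le 0 l p6.
set F6 := _ ^+ 2; set F0 := Normc.normc _ ^+ 2 => leF6 E.
set x : R := l%:~R ^+ 2; have x1 : 1 <= x.
  rewrite /x -rmorphXn /= ler1z -gtz0_ge1 lt_neqAle sqr_ge0 andbT eq_sym.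
  by rewrite expf_neq0.
have x0 : 0 < x by apply: lt_le_trans x1.
have F00 : 0 <= F0 by exact: sqr_ge0.
rewrite ler_pdivlMr//.
move: {mean0} leF6 => leF6.
have E' : x ^+ 6 * F0 = F6 by rewrite -E /x -exprM.
apply: le_trans (_ : (2 * x) ^+ 4 * F0 * x <= _).
  rewrite ler_wpM2r ?(ltW x0)// ler_wpM2r// lerXn2r ?nnegrE; lra.
apply: le_trans (_ : 16 * (x ^+ 6 * F0) <= _); last first.
  by rewrite E'; move: leF6; lra.
rewrite (_ : (2 * x) ^+ 4 * F0 * x = 16 * (x ^+ 5 * F0)); last by ring.
by rewrite ler_wpM2l// ler_wpM2r// ler_weXn2l.
Qed.

(** For a function of $\zeta$ alone, being even amounts to having real Fourier
    coefficients, that is to the vanishing of the sine integrals. *)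
Lemma zeta_L2ev B f : profile B f -> cos_int f 0 0 = 0 ->
  (forall l, sin_int f 0 l = 0) -> L2ev (zeta_fun f).
Proof.
move=> pf c0 s0; split; first exact: profile_L2 pf.
- move=> k l; have [->|k0] := eqVneq k 0; last first.
    by rewrite !(fourier_theta_eq0 _ pf k0).
  rewrite !fourierE !s0; congr (Complex (_ * _) _).
  congr Rintegral; apply/funext => x; congr (_ * _).
  by rewrite -cosN; congr cos; rewrite /phase mulrNz; ring.
- by rewrite fourierE c0 s0 !mulr0 oppr0.
Qed.

End zeta_fourier.

(** * Formal sums *)

Section formal_sums.
Variable R : realType.

(** An entry $(c, (n, k))$ stands for $c\, e^{n \omega t} \cos(k J \zeta)$, or
    for the same with a sine. Entries with equal indices are not collected: as
    nothing ever cancels, the operations below are monotone for the inclusion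
    of multisets. *)
Definition formal_sum := seq (R * (nat * int)).
Implicit Types (p q : formal_sum) (f g w : nat * int -> R).

Definition pairing f p : R := \sum_(x <- p) x.1 * f x.2.

Definition wnorm w p : R := \sum_(x <- p) `|x.1| * w x.2.

Definition multiplier f p : formal_sum := [seq (f x.2 * x.1, x.2) | x <- p].

(** The two halves are the two terms of the product-to-sum formulas. As $\cos$
    is even, the same indices serve for $\cos \cdot \cos$ and for $\cos \cdot
    \sin$, provided that the left factor is the cosine. *)
Definition cmul p q : formal_sum :=
  [seq (x.1 * y.1 / 2, ((x.2.1 + y.2.1)%N, y.2.2 + x.2.2)) | x <- p, y <- q] ++
  [seq (x.1 * y.1 / 2, ((x.2.1 + y.2.1)%N, y.2.2 - x.2.2)) | x <- p, y <- q].

(** Inclusion of multisets. *)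
Definition subsum p q := exists r, perm_eq q (p ++ r).

Definition degree_ge d p := all (fun x : R * (nat * int) => (d <= x.2.1)%N) p.

Lemma pairing_cat f p q : pairing f (p ++ q) = pairing f p + pairing f q.
Proof. exact: big_cat. Qed.

Lemma wnorm_cat w p q : wnorm w (p ++ q) = wnorm w p + wnorm w q.
Proof. exact: big_cat. Qed.

Lemma pairing_multiplier f g p :
  pairing g (multiplier f p) = pairing (fun i => f i * g i) p.
Proof. by rewrite /pairing big_map; apply: eq_bigr => x _ /=; ring. Qed.

Lemma wnorm_multiplier f w p :
  wnorm w (multiplier f p) = wnorm (fun i => `|f i| * w i) p.
Proof.
by rewrite /wnorm big_map; apply: eq_bigr => x _ /=; rewrite normrM; ring.
Qed.

Lemma le_wnorm w w' p : (forall i, w i <= w' i) -> wnorm w p <= wnorm w' p.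
Proof. by move=> ww'; apply: ler_sum => x _; rewrite ler_wpM2l. Qed.

Lemma wnorm_ge0 w p : (forall i, 0 <= w i) -> 0 <= wnorm w p.
Proof. by move=> w0; apply: sumr_ge0 => x _; rewrite mulr_ge0. Qed.

Lemma wnormZ c w p : wnorm (fun i => c * w i) p = c * wnorm w p.
Proof. by rewrite /wnorm mulr_sumr; apply: eq_bigr => x _; ring. Qed.

Lemma pairingD a b f g p : pairing (fun i => a * f i + b * g i) p =
  a * pairing f p + b * pairing g p.
Proof.
rewrite /pairing !mulr_sumr -big_split/=.
by apply: eq_bigr => x _; ring.
Qed.

Lemma eq_pairing_degree d f g p : degree_ge d p ->
  (forall i, (d <= i.1)%N -> f i = g i) -> pairing f p = pairing g p.
Proof.
move=> /allP dp fg; rewrite /pairing !big_seq; apply: eq_bigr => x xp.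
by rewrite fg// dp.
Qed.

Lemma le_pairing w f p : (forall i, `|f i| <= w i) ->
  `|pairing f p| <= wnorm w p.
Proof.
move=> fw; apply: le_trans (ler_norm_sum _ _ _) _.
by apply: ler_sum => x _; rewrite normrM ler_wpM2l.
Qed.

Definition submultiplicative w := forall n n' k k',
  w ((n + n')%N, k' + k) <= w (n, k) * w (n', k') /\
  w ((n + n')%N, k' - k) <= w (n, k) * w (n', k').

Lemma wnorm_cmul w p q : submultiplicative w ->
  wnorm w (cmul p q) <= wnorm w p * wnorm w q.
Proof.
move=> sw.
have half (e : int -> int -> int) : (forall n n' k k',
      w ((n + n')%N, e k k') <= w (n, k) * w (n', k')) ->
    wnorm w [seq (x.1 * y.1 / 2, ((x.2.1 + y.2.1)%N, e x.2.2 y.2.2)) |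
      x <- p, y <- q] <= (wnorm w p * wnorm w q) / 2.
  move=> we; rewrite /wnorm big_allpairs_dep/= big_distrlr/= mulr_suml.
  apply: ler_sum => -[a [n k]] _ /=; rewrite mulr_suml.
  apply: ler_sum => -[b [n' k']] _ /=.
  rewrite !normrM (ger0_norm (_ : 0 <= 2^-1))// (_ : _ / 2 * _ =
    `|a| * `|b| / 2 * w ((n + n')%N, e k k'))//.
  rewrite (_ : _ * w (n, k) * _ / 2 = `|a| * `|b| / 2 * (w (n, k) * w (n', k'))).
    by rewrite ler_wpM2l// !mulr_ge0.
  by ring.
rewrite /cmul wnorm_cat.
apply: le_trans (lerD (half (fun k k' => k' + k) _) (half (fun k k' => k' - k) _)) _.
- by move=> n n' k k'; have [] := sw n n' k k'.
- by move=> n n' k k'; have [] := sw n n' k k'.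
by lra.
Qed.

Lemma subsum_refl p : subsum p p.
Proof. by exists [::]; rewrite cats0. Qed.

Lemma subsum0 p : subsum [::] p.
Proof. by exists p. Qed.

Lemma subsum_cat p p' q q' :
  subsum p p' -> subsum q q' -> subsum (p ++ q) (p' ++ q').
Proof.
move=> [r pr] [s qs]; exists (r ++ s).
apply: perm_trans (perm_cat pr qs) _.
by rewrite -!catA perm_cat2l perm_catCA.
Qed.

Lemma subsum_map (h : R * (nat * int) -> R * (nat * int)) p q :
  subsum p q -> subsum (map h p) (map h q).
Proof. by move=> [r pr]; exists (map h r); rewrite -map_cat perm_map. Qed.

Lemma subsum_allpairs (h : R * (nat * int) -> R * (nat * int) -> R * (nat * int))
    p p' q q' : subsum p p' -> subsum q q' ->
  subsum [seq h x y | x <- p, y <- q] [seq h x y | x <- p', y <- q'].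
Proof.
move=> [r pr] [s qs].
exists ([seq h x y | x <- p, y <- s] ++ [seq h x y | x <- r, y <- q ++ s]).
apply: perm_trans (_ : perm_eq _ [seq h x y | x <- p ++ r, y <- q ++ s]) _.
  exact: perm_allpairs.
rewrite allpairs_cat catA perm_cat2r.
exact/permPl/perm_allpairs_catr.
Qed.

Lemma subsum_cmul p p' q q' :
  subsum p p' -> subsum q q' -> subsum (cmul p q) (cmul p' q').
Proof. by move=> pp' qq'; apply: subsum_cat; exact: subsum_allpairs. Qed.

Lemma le_pairing_subsum w f p q : subsum p q -> (forall i, `|f i| <= w i) ->
  `|pairing f q - pairing f p| <= wnorm w q - wnorm w p.
Proof.
move=> [r pr] fw.
have -> : pairing f q = pairing f (p ++ r) by exact: perm_big.
have -> : wnorm w q = wnorm w (p ++ r) by exact: perm_big.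
rewrite pairing_cat wnorm_cat.
by rewrite addrC addKr addrC addKr; exact: le_pairing.
Qed.

Lemma degree_ge_cat d p q :
  degree_ge d p -> degree_ge d q -> degree_ge d (p ++ q).
Proof. by rewrite /degree_ge all_cat => -> ->. Qed.

Lemma degree_ge_multiplier d f p : degree_ge d p -> degree_ge d (multiplier f p).
Proof. by rewrite /degree_ge all_map. Qed.

Lemma degree_ge_cmul d e p q :
  degree_ge d p -> degree_ge e q -> degree_ge (d + e) (cmul p q).
Proof.
move=> /allP dp /allP eq; apply: degree_ge_cat.
all: apply/allP => _ /allpairsP[[x y] /= [xp yq ->]] /=.
all: by apply: leq_add; [exact: dp|exact: eq].
Qed.

Lemma degree_geW d e p : (e <= d)%N -> degree_ge d p -> degree_ge e p.
Proof. by move=> ed; apply: sub_all => x; exact: leq_trans. Qed.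

End formal_sums.

(** * Limits of growing formal sums *)

Section chains.
Variable R : realType.
Implicit Types (p : nat -> formal_sum R) (q : formal_sum R) (S B : R).
Implicit Types (f g w : nat * int -> R).

Definition chain w p S :=
  (forall N, subsum (p N) (p N.+1)) /\ (forall N, wnorm w (p N) <= S).

Definition plim f p : R := limn (fun N => pairing f (p N)).

(** The terms added along a chain never cancel, so the norms increase and their
    convergence controls every pairing at once. *)
Lemma chain_limit w p S : (forall i, 0 <= w i) -> chain w p S ->
  exists2 eps : nat -> R, eps @ \oo --> 0 &
  forall f B, 0 <= B -> (forall i, `|f i| <= B * w i) ->
  [/\ (fun N => pairing f (p N)) @ \oo --> plim f p,
      forall N, `|plim f p - pairing f (p N)| <= B * eps N &
      `|plim f p| <= B * S].
Proof.
move=> w0 [sp pS].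
pose b N := wnorm w (p N).
have ndb : nondecreasing_seq b.
  apply/nondecreasing_seqP => N; rewrite -subr_ge0.
  apply: le_trans (le_pairing_subsum (f := fun=> 0) (sp N) _); first exact: normr_ge0.
  by move=> i; rewrite normr0.
have cb : cvgn b.
  by apply: nondecreasing_is_cvgn => //; exists S => _ [N _ <-]; exact: pS.
exists (fun N => limn b - b N).
  by rewrite -[X in _ --> X](subrr (limn b)); apply: cvgB => //; exact: cvg_cst.
move=> f B B0 fw; pose a N := pairing f (p N).
have fBw q : `|pairing f q| <= B * wnorm w q.
  by rewrite -wnormZ; exact: le_pairing.
have step N M : (N <= M)%N -> `|a M - a N| <= B * (b M - b N).
  move=> NM; have [r ->] : exists r, M = (N + r)%N.
    by exists (M - N)%N; rewrite subnKC.
  elim: r {M NM} => [|r IH]; first by rewrite addn0 !subrr normr0 mulr0.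
  rewrite addnS -(subrK (a (N + r)%N) (a _)) -addrA.
  apply: le_trans (ler_normD _ _) _.
  rewrite (_ : b _ - b N = (b (N + r).+1 - b (N + r)%N) + (b (N + r)%N - b N));
    last by ring.
  rewrite mulrDr lerD// mulrBr -!wnormZ; exact: le_pairing_subsum.
(* The increments of [a] are dominated by those of [B * b], so this sum is
   nondecreasing and bounded. *)
have cab : cvgn (a \+ (fun N => B * b N)).
  apply: nondecreasing_is_cvgn.
    apply/nondecreasing_seqP => N /=.
    by have := step N N.+1 (leqnSn N); rewrite ler_norml; lra.
  exists (B * S + B * S) => _ [N _ <-] /=.
  have BbS : B * b N <= B * S by rewrite ler_wpM2l// pS.
  have := fBw (p N); rewrite ler_norml -/(b N) -/(a N); lra.
have ca : a @ \oo --> plim f p.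
  have : cvgn a.
    have -> : a = (a \+ (fun N => B * b N)) \- (fun N => B * b N).
      by apply/funext => N /=; ring.
    by apply: is_cvgB => //; apply: is_cvgM => //; exact: is_cvg_cst.
  by [].
have cBb : (fun N => B * b N) @ \oo --> B * limn b.
  by apply: cvgM => //; exact: cvg_cst.
split => // [N|].
  have cl : (fun M => `|a M - a N|) @ \oo --> `|plim f p - a N|.
    by apply: cvg_norm; apply: cvgB => //; exact: cvg_cst.
  have cr : (fun M => B * b M - B * b N) @ \oo --> B * limn b - B * b N.
    by apply: cvgB => //; exact: cvg_cst.
  rewrite mulrBr; apply: ler_cvg_to cl cr _.
  by exists N => // M /= NM; rewrite -mulrBr; exact: step.
have cn : (fun N => `|a N|) @ \oo --> `|plim f p| by exact: cvg_norm.
rewrite -(cvg_lim (@Rhausdorff R) cn); apply: limr_le.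
  by apply/cvg_ex; eexists; exact: cn.
by apply: nearW => N; apply: le_trans (fBw _) _; rewrite ler_wpM2l ?pS.
Qed.

Lemma eq_plim f f' p p' :
  (forall N, pairing f (p N) = pairing f' (p' N)) -> plim f p = plim f' p'.
Proof. by move=> e; congr (limn _); apply/funext => N. Qed.

End chains.

(** * Trigonometric sums and series *)

Section trig_series.
Variables (R : realType) (J : nat).
Implicit Types (p : nat -> formal_sum R) (q : formal_sum R) (S B : R).
Implicit Types (g w : nat * int -> R) (y : R).

Definition freq (k : int) : R := J%:R * k%:~R.

Definition cos_sum g q y : R := pairing (fun i => g i * cos (freq i.2 * y)) q.
Definition sin_sum g q y : R := pairing (fun i => g i * sin (freq i.2 * y)) q.
Definition cos_series g p y : R := plim (fun i => g i * cos (freq i.2 * y)) p.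
Definition sin_series g p y : R := plim (fun i => g i * sin (freq i.2 * y)) p.

Lemma freq_intr k : freq k = (J%:Z * k)%:~R.
Proof. by rewrite /freq intrM. Qed.

Lemma freq0 : freq 0 = 0.
Proof. by rewrite /freq mulr0. Qed.

Lemma is_derive_freq k y : is_derive y (1 : R) (fun y : R => freq k * y) (freq k).
Proof. by apply: is_derive_eq; rewrite /GRing.scale/=; ring. Qed.

Lemma is_derive_cos_sum g q y : is_derive y (1 : R) (cos_sum g q)
  (sin_sum (fun i => - freq i.2 * g i) q y).
Proof.
elim: q => [|[c [n k]] q IH].
  have -> : cos_sum g [::] = fun=> 0.
    by apply/funext => z; rewrite /cos_sum /pairing big_nil.
  by rewrite /sin_sum /pairing big_nil; exact: is_derive_cst.
have -> : cos_sum g ((c, (n, k)) :: q) =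
    (c * g (n, k)) *: (cos \o (fun y => freq k * y)) + cos_sum g q.
  apply/funext => z; rewrite /cos_sum /pairing big_cons.
  by rewrite !fctE /GRing.scale/= mulrA.
rewrite /sin_sum /pairing big_cons -/(pairing _ q) -/(sin_sum _ q y) /=.
rewrite (_ : c * (- freq k * g (n, k) * sin (freq k * y)) =
  (c * g (n, k)) *: (- sin (freq k * y) * freq k)); last first.
  by rewrite /GRing.scale/=; ring.
apply: is_deriveD; apply: is_deriveZ.
exact: is_derive1_comp (is_derive_cos _) (is_derive_freq k y).
Qed.

Lemma is_derive_sin_sum g q y : is_derive y (1 : R) (sin_sum g q)
  (cos_sum (fun i => freq i.2 * g i) q y).
Proof.
elim: q => [|[c [n k]] q IH].
  have -> : sin_sum g [::] = fun=> 0.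
    by apply/funext => z; rewrite /sin_sum /pairing big_nil.
  by rewrite /cos_sum /pairing big_nil; exact: is_derive_cst.
have -> : sin_sum g ((c, (n, k)) :: q) =
    (c * g (n, k)) *: (sin \o (fun y => freq k * y)) + sin_sum g q.
  apply/funext => z; rewrite /sin_sum /pairing big_cons.
  by rewrite !fctE /GRing.scale/= mulrA.
rewrite /cos_sum /pairing big_cons -/(pairing _ q) -/(cos_sum _ q y) /=.
rewrite (_ : c * (freq k * g (n, k) * cos (freq k * y)) =
  (c * g (n, k)) *: (cos (freq k * y) * freq k)); last first.
  by rewrite /GRing.scale/=; ring.
apply: is_deriveD; apply: is_deriveZ.
exact: is_derive1_comp (is_derive_sin _) (is_derive_freq k y).
Qed.

Lemma is_derive_continuous (f f' : R -> R) :
  (forall y : R, is_derive y (1 : R) f (f' y)) -> continuous f.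
Proof.
move=> df y; apply: differentiable_continuous.
by apply/derivable1_diffP; exact: ex_derive.
Qed.

Lemma continuous_cos_sum g q : continuous (cos_sum g q).
Proof. exact: is_derive_continuous (is_derive_cos_sum g q). Qed.

Lemma continuous_sin_sum g q : continuous (sin_sum g q).
Proof. exact: is_derive_continuous (is_derive_sin_sum g q). Qed.

Lemma cos_term_le w g B y : (forall i, `|g i| <= B * w i) ->
  forall i, `|g i * cos (freq i.2 * y)| <= B * w i.
Proof.
by move=> gw i; rewrite normrM -[_ * w i]mulr1 ler_pM// cos_max.
Qed.

Lemma sin_term_le w g B y : (forall i, `|g i| <= B * w i) ->
  forall i, `|g i * sin (freq i.2 * y)| <= B * w i.
Proof.
by move=> gw i; rewrite normrM -[_ * w i]mulr1 ler_pM// sin_max.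
Qed.

Lemma cos_freq_periodic k y : cos (freq k * (y + 2 * pi)) = cos (freq k * y).
Proof. by rewrite mulrDr [in X in _ + X]freq_intr cosD2piz. Qed.

Lemma sin_freq_periodic k y : sin (freq k * (y + 2 * pi)) = sin (freq k * y).
Proof. by rewrite mulrDr [in X in _ + X]freq_intr sinD2piz. Qed.

Lemma profile_cos_sum w g B q : (forall i, `|g i| <= B * w i) ->
  profile (B * wnorm w q) (cos_sum g q).
Proof.
move=> gw; split.
- by move=> y; apply: eq_bigr => x _; rewrite cos_freq_periodic.
- by apply: continuous_measurable_fun; exact: continuous_cos_sum.
- by move=> y; rewrite -wnormZ; apply: le_pairing; exact: cos_term_le.
Qed.

Lemma profile_sin_sum w g B q : (forall i, `|g i| <= B * w i) ->
  profile (B * wnorm w q) (sin_sum g q).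
Proof.
move=> gw; split.
- by move=> y; apply: eq_bigr => x _; rewrite sin_freq_periodic.
- by apply: continuous_measurable_fun; exact: continuous_sin_sum.
- by move=> y; rewrite -wnormZ; apply: le_pairing; exact: sin_term_le.
Qed.

Section along_a_chain.
Variables (w : nat * int -> R) (p : nat -> formal_sum R) (S : R).
Hypotheses (w0 : forall i, 0 <= w i) (wp : chain w p S).

Lemma cos_series_cvg g B y : 0 <= B -> (forall i, `|g i| <= B * w i) ->
  (fun N => cos_sum g (p N) y) @ \oo --> cos_series g p y.
Proof.
move=> B0 gw; have [eps _ lim] := chain_limit w0 wp.
by have [] := lim _ _ B0 (cos_term_le y gw).
Qed.

Lemma sin_series_cvg g B y : 0 <= B -> (forall i, `|g i| <= B * w i) ->
  (fun N => sin_sum g (p N) y) @ \oo --> sin_series g p y.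
Proof.
move=> B0 gw; have [eps _ lim] := chain_limit w0 wp.
by have [] := lim _ _ B0 (sin_term_le y gw).
Qed.

Lemma profile_cos_series g B : 0 <= B -> (forall i, `|g i| <= B * w i) ->
  profile (B * S) (cos_series g p).
Proof.
move=> B0 gw; have [eps _ lim] := chain_limit w0 wp; split.
- by move=> y; apply: eq_plim => N; apply: eq_bigr => x _; rewrite cos_freq_periodic.
- apply: (@measurable_fun_cvg _ _ _ _ (fun N => cos_sum g (p N))) => [N|y _].
    by apply: continuous_measurable_fun; exact: continuous_cos_sum.
  exact: cos_series_cvg gw.
- by move=> y; have [] := lim _ _ B0 (cos_term_le y gw).
Qed.

Lemma profile_sin_series g B : 0 <= B -> (forall i, `|g i| <= B * w i) ->
  profile (B * S) (sin_series g p).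
Proof.
move=> B0 gw; have [eps _ lim] := chain_limit w0 wp; split.
- by move=> y; apply: eq_plim => N; apply: eq_bigr => x _; rewrite sin_freq_periodic.
- apply: (@measurable_fun_cvg _ _ _ _ (fun N => sin_sum g (p N))) => [N|y _].
    by apply: continuous_measurable_fun; exact: continuous_sin_sum.
  exact: sin_series_cvg gw.
- by move=> y; have [] := lim _ _ B0 (sin_term_le y gw).
Qed.

Lemma cos_series_uniform g B : 0 <= B -> (forall i, `|g i| <= B * w i) ->
  exists2 eps : nat -> R, eps @ \oo --> 0 &
  forall N, profile (eps N) (fun y => cos_series g p y - cos_sum g (p N) y).
Proof.
move=> B0 gw; have [eps eps0 lim] := chain_limit w0 wp.
exists (fun N => B * eps N) => [|N].
  by rewrite -(mulr0 B); apply: cvgM => //; exact: cvg_cst.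
have [per m _] := profile_cos_series B0 gw.
have [perN mN _] := profile_cos_sum (p N) gw.
split.
- by move=> y; rewrite per perN.
- exact: measurable_funB.
- by move=> y; have [_ + _] := lim _ _ B0 (cos_term_le y gw); exact.
Qed.

Lemma sin_series_uniform g B : 0 <= B -> (forall i, `|g i| <= B * w i) ->
  exists2 eps : nat -> R, eps @ \oo --> 0 &
  forall N, profile (eps N) (fun y => sin_series g p y - sin_sum g (p N) y).
Proof.
move=> B0 gw; have [eps eps0 lim] := chain_limit w0 wp.
exists (fun N => B * eps N) => [|N].
  by rewrite -(mulr0 B); apply: cvgM => //; exact: cvg_cst.
have [per m _] := profile_sin_series B0 gw.
have [perN mN _] := profile_sin_sum (p N) gw.
split.
- by move=> y; rewrite per perN.
- exact: measurable_funB.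
- by move=> y; have [_ + _] := lim _ _ B0 (sin_term_le y gw); exact.
Qed.

Lemma cos_series_dzeta g B C : 0 <= B -> 0 <= C ->
  (forall i, `|g i| <= B * w i) -> (forall i, `|freq i.2 * g i| <= C * w i) ->
  is_dzeta (zeta_fun (cos_series g p))
    (zeta_fun (sin_series (fun i => - freq i.2 * g i) p)).
Proof.
move=> B0 C0 gw fgw.
have gw' i : `|- freq i.2 * g i| <= C * w i by rewrite mulNr normrN.
have [e1 e10 le1] := cos_series_uniform B0 gw.
have [e2 e20 le2] := sin_series_uniform C0 gw'.
apply: (@weak_dzeta_uniform _ _ _ _ _ (fun N => cos_sum g (p N))
  (fun N => sin_sum (fun i => - freq i.2 * g i) (p N)) (fun N => e1 N + e2 N)).
- exact: profile_cos_series B0 gw.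
- exact: profile_sin_series C0 gw'.
- move=> N; apply: profile_weak_dzeta.
  + exact: profile_cos_sum gw.
  + exact: profile_sin_sum gw'.
  + exact: continuous_cos_sum.
  + exact: continuous_sin_sum.
  + exact: is_derive_cos_sum.
- by move=> N; apply: profile_le (le1 N); rewrite lerDl (profile_ge0 (le2 N)).
- by move=> N; apply: profile_le (le2 N); rewrite lerDr (profile_ge0 (le1 N)).
- by rewrite -[X in _ --> X](addr0 0); exact: cvgD.
Qed.

Lemma sin_series_dzeta g B C : 0 <= B -> 0 <= C ->
  (forall i, `|g i| <= B * w i) -> (forall i, `|freq i.2 * g i| <= C * w i) ->
  is_dzeta (zeta_fun (sin_series g p))
    (zeta_fun (cos_series (fun i => freq i.2 * g i) p)).
Proof.
move=> B0 C0 gw fgw.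
have [e1 e10 le1] := sin_series_uniform B0 gw.
have [e2 e20 le2] := cos_series_uniform C0 fgw.
apply: (@weak_dzeta_uniform _ _ _ _ _ (fun N => sin_sum g (p N))
  (fun N => cos_sum (fun i => freq i.2 * g i) (p N)) (fun N => e1 N + e2 N)).
- exact: profile_sin_series B0 gw.
- exact: profile_cos_series C0 fgw.
- move=> N; apply: profile_weak_dzeta.
  + exact: profile_sin_sum gw.
  + exact: profile_cos_sum fgw.
  + exact: continuous_sin_sum.
  + exact: continuous_cos_sum.
  + exact: is_derive_sin_sum.
- by move=> N; apply: profile_le (le1 N); rewrite lerDl (profile_ge0 (le2 N)).
- by move=> N; apply: profile_le (le2 N); rewrite lerDr (profile_ge0 (le1 N)).
- by rewrite -[X in _ --> X](addr0 0); exact: cvgD.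
Qed.

Lemma cos_seriesD a b g h B C y : 0 <= B -> 0 <= C ->
  (forall i, `|g i| <= B * w i) -> (forall i, `|h i| <= C * w i) ->
  cos_series (fun i => a * g i + b * h i) p y =
  a * cos_series g p y + b * cos_series h p y.
Proof.
move=> B0 C0 gw hw; apply: cvg_lim => //.
have -> : (fun N => pairing (fun i => (a * g i + b * h i) * cos (freq i.2 * y)) (p N))
    = (fun N => a * cos_sum g (p N) y + b * cos_sum h (p N) y).
  apply/funext => N; rewrite -pairingD; apply: eq_bigr => x _; congr (_ * _).
  by ring.
by apply: cvgD; (apply: cvgM; first exact: cvg_cst);
  [exact: cos_series_cvg gw|exact: cos_series_cvg hw].
Qed.

End along_a_chain.
End trig_series.

(** * Products, mean values and Sobolev norms of series *)

Section series_products.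
Variables (R : realType) (J : nat) (tau : nat -> R).
Hypothesis tauM : forall n n', tau (n + n')%N = tau n * tau n'.
Local Notation g := (fun i : nat * int => tau i.1).

(** Product-to-sum formulas; the time factors multiply because $\tau$ is
    exponential. *)
Lemma cos_sum_cmul (p q : formal_sum R) y :
  cos_sum J g (cmul p q) y = cos_sum J g p y * cos_sum J g q y.
Proof.
rewrite /cos_sum /cmul pairing_cat /pairing !big_allpairs_dep/= big_distrlr/=.
rewrite -big_split/=; apply: eq_bigr => -[c [n k]] _ /=.
rewrite -big_split/=; apply: eq_bigr => -[d [n' k']] _ /=.
rewrite tauM /freq intrB intrD !mulrDr !mulrDl !mulrN !mulNr cosB cosD.
by field.
Qed.

Lemma sin_sum_cmul (p q : formal_sum R) y :
  sin_sum J g (cmul p q) y = cos_sum J g p y * sin_sum J g q y.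
Proof.
rewrite /cos_sum /sin_sum /cmul pairing_cat /pairing !big_allpairs_dep/=.
rewrite big_distrlr/=.
rewrite -big_split/=; apply: eq_bigr => -[c [n k]] _ /=.
rewrite -big_split/=; apply: eq_bigr => -[d [n' k']] _ /=.
rewrite tauM /freq intrB intrD !mulrDr !mulrDl !mulrN !mulNr sinB sinD.
by field.
Qed.

End series_products.

Section vanishing_integrals.
Variables (R : realType) (J : nat).
Local Notation mu := (torus_measure R).

Lemma profile_cst (c : R) : profile `|c| (fun=> c).
Proof. by split. Qed.

Lemma cst_dzeta : is_dzeta (zeta_fun (fun=> 1 : R)) (zeta_fun (fun=> 0 : R)).
Proof.
apply: (profile_weak_dzeta (profile_cst 1) (profile_cst 0)).
- by move=> y; exact: cvg_cst.
- by move=> y; exact: cvg_cst.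
Qed.

Lemma character_integral n :
  (n != 0 -> Rintegral mu setT (fun x => cos (phase 0 n x)) = 0) /\
  Rintegral mu setT (fun x => sin (phase 0 n x)) = 0.
Proof.
have := weak_deriv_trig 0 n (profile_torus_bounded (profile_cst 1)) cst_dzeta.
have -> : phase 0 n ((0, 1) : R * R) = n%:~R by rewrite /phase/=; ring.
have int0 (phi : R * R -> R) : Rintegral mu setT (fun x => zeta_fun (fun=> 0) x * phi x) = 0.
  rewrite (_ : (fun x => _) = fun=> 0); last by apply/funext => x; exact: mul0r.
  by rewrite Rintegral_cst// mul0r.
have int1 (phi : R * R -> R) : Rintegral mu setT (fun x => zeta_fun (fun=> 1) x * phi x) =
    Rintegral mu setT phi.
  by congr Rintegral; apply/funext => x; exact: mul1r.
rewrite !int0 !int1 oppr0 => -[/eqP s0 /eqP c0].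
move: s0 c0; rewrite !mulf_eq0 intr_eq0; have [->|n0] /= := eqVneq n 0.
  move=> _ _; split => //.
  rewrite (_ : (fun x => _) = fun=> 0); first by rewrite Rintegral_cst// mul0r.
  by apply/funext => x; rewrite /phase !mul0r addr0 sin0.
by move=> /eqP s0 /eqP c0; split.
Qed.

Definition mean_free (q : formal_sum R) :=
  all (fun x : R * (nat * int) => (x.2.2 != 0) || (x.1 == 0)) q.

Lemma cos_sum_integral_eq0 (g : nat * int -> R) (q : formal_sum R)
    (phi : R * R -> R) : torus_bounded phi ->
  (forall x, x \in q -> x.1 != 0 ->
     Rintegral mu setT (fun z => cos (freq R J x.2.2 * z.2) * phi z) = 0) ->
  Rintegral mu setT (fun z => zeta_fun (cos_sum J g q) z * phi z) = 0.
Proof.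
move=> bphi.
have bcos (h : nat * int -> R) r : torus_bounded (zeta_fun (cos_sum J h r)).
  apply: continuous_torus_bounded => z; apply: continuous_comp; first exact: cvg_snd.
  exact: continuous_cos_sum.
elim: q => [|[c [n k]] q IH] q0.
  rewrite (_ : (fun x => _) = fun=> 0); first by rewrite Rintegral_cst// mul0r.
  by apply/funext => x; rewrite /zeta_fun /cos_sum /pairing big_nil mul0r.
rewrite (_ : (fun x => _) = fun x =>
    (c * g (n, k)) * (cos (freq R J k * x.2) * phi x) +
    zeta_fun (cos_sum J g q) x * phi x); last first.
  apply/funext => x; rewrite /zeta_fun /cos_sum /pairing big_cons /=; ring.
have bck : torus_bounded (fun x : R * R => cos (freq R J k * x.2) * phi x).
  apply: torus_boundedM => //; apply: continuous_torus_bounded => z.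
  apply: continuous_comp; last exact: continuous_cos.
  by apply: cvgM; [exact: cvg_cst|exact: cvg_snd].
rewrite RintegralD//; first last.
- exact/torus_bounded_integrable/torus_boundedM.
- by apply: torus_bounded_integrable; apply: torus_boundedM => //; exact: torus_bounded_cst.
rewrite IH ?addr0; last by move=> x xq; apply: q0; rewrite inE xq orbT.
rewrite RintegralZl//; last exact: torus_bounded_integrable.
have [->|c0] := eqVneq c 0; first by rewrite !mul0r.
by rewrite (q0 _ (mem_head _ _))// mulr0.
Qed.

Lemma uniform_integral_eq0 (B : R) (f : R -> R) (fN : nat -> R -> R)
    (eps : nat -> R) (phi : R * R -> R) :
  torus_bounded phi -> profile B f ->
  (forall N, profile (eps N) (fun y => f y - fN N y)) -> eps @ \oo --> 0 ->
  (forall N, Rintegral mu setT (fun z => zeta_fun (fN N) z * phi z) = 0) ->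
  Rintegral mu setT (fun z => zeta_fun f z * phi z) = 0.
Proof.
move=> bphi pf fe eps0 fN0; have [K K0 leK] := le_profile_pairing bphi.
apply/eqP; rewrite -normr_eq0; set a := `|_|.
suff a0 : a <= 0 by rewrite eq_le a0 /a/=.
have epsK : (fun N => eps N * K) @ \oo --> (0 : R).
  by rewrite -(mul0r K); apply: cvgM eps0 _; exact: cvg_cst.
rewrite -(cvg_lim (@Rhausdorff R) epsK); apply: limr_ge.
  by apply/cvg_ex; exists 0.
apply: nearW => N; have := leK _ _ (fe N).
by rewrite (RintegralB_profile pf (profile_approx pf (fe N)) bphi) fN0 subr0.
Qed.

Variables (w : nat * int -> R) (p : nat -> formal_sum R) (S B : R).
Variable g : nat * int -> R.
Hypotheses (J0 : J != 0%N) (w0 : forall i, 0 <= w i) (wp : chain w p S).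
Hypotheses (mp : forall N, mean_free (p N)) (B0 : 0 <= B).
Hypothesis gw : forall i, `|g i| <= B * w i.

Lemma cos_series_integral_eq0 (phi : R * R -> R) : torus_bounded phi ->
  (forall k, k != 0 ->
     Rintegral mu setT (fun z => cos (freq R J k * z.2) * phi z) = 0) ->
  Rintegral mu setT (fun z => zeta_fun (cos_series J g p) z * phi z) = 0.
Proof.
move=> bphi phi0; have [eps eps0 leps] := cos_series_uniform J w0 wp B0 gw.
apply: (uniform_integral_eq0 bphi (profile_cos_series J w0 wp B0 gw) leps eps0).
move=> N; apply: cos_sum_integral_eq0 => // x xp x0; apply: phi0.
by have /allP /(_ _ xp) := mp N; rewrite (negbTE x0) orbF.
Qed.

Lemma freq_phase (k : int) (z : R * R) : freq R J k * z.2 = phase 0 (J%:Z * k) z.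
Proof. by rewrite freq_intr /phase mul0r add0r. Qed.

Lemma cos_series_L2ev : L2ev (zeta_fun (cos_series J g p)).
Proof.
apply: (zeta_L2ev (profile_cos_series J w0 wp B0 gw)).
  apply: cos_series_integral_eq0 => [|k k0].
    exact/continuous_torus_bounded/continuous_cos_phase.
  rewrite (_ : (fun z => _) = fun z => cos (phase 0 (J%:Z * k) z)).
    by apply: (character_integral _).1; rewrite mulf_neq0.
  apply/funext => z; rewrite freq_phase /phase !mul0r add0r.
  by rewrite addr0 cos0 mulr1.
move=> l; apply: cos_series_integral_eq0 => [|k k0].
  exact/continuous_torus_bounded/continuous_sin_phase.
have bs n : torus_bounded (fun z : R * R => sin (phase 0 n z)).
  exact/continuous_torus_bounded/continuous_sin_phase.
rewrite (_ : (fun z => _) = fun z => 2^-1 * sin (phase 0 (l + J%:Z * k) z) +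
    2^-1 * sin (phase 0 (l - J%:Z * k) z)).
  rewrite RintegralD//; first last.
  - by apply/torus_bounded_integrable/torus_boundedM => //; exact: torus_bounded_cst.
  - by apply/torus_bounded_integrable/torus_boundedM => //; exact: torus_bounded_cst.
  rewrite !RintegralZl//; try exact: torus_bounded_integrable.
  by rewrite !(character_integral _).2 !mulr0 addr0.
apply/funext => z; rewrite freq_phase.
have -> : phase 0 (l + J%:Z * k) z = phase 0 l z + phase 0 (J%:Z * k) z.
  by rewrite /phase intrD; ring.
have -> : phase 0 (l - J%:Z * k) z = phase 0 l z - phase 0 (J%:Z * k) z.
  by rewrite /phase intrB; ring.
by rewrite sinB sinD; field.
Qed.

End vanishing_integrals.

Section series_sobolev.
Variables (R : realType) (J : nat).
Variables (p : nat -> formal_sum R) (S : R).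

(** The factor $4^n$ pays for two time derivatives, since $n^2 \le 4^n$, and
    each factor $1 + |k|$ for one derivative in $\zeta$. *)
Definition weight (r : nat) (i : nat * int) : R :=
  4 ^+ i.1 * (1 + `|i.2%:~R|) ^+ r.

Lemma weight_ge0 r i : 0 <= weight r i.
Proof. by rewrite mulr_ge0 ?exprn_ge0// addr_ge0. Qed.

Lemma weight_le r s i : (r <= s)%N -> weight r i <= weight s i.
Proof.
move=> rs; rewrite ler_wpM2l ?exprn_ge0//.
by rewrite ler_weXn2l// lerDl.
Qed.

Lemma weight_submultiplicative r : submultiplicative (weight r).
Proof.
move=> n n' k k'; rewrite /weight /= exprD mulrACA -exprMn.
have le (a : R) : a <= `|k%:~R| + `|k'%:~R| ->
    1 + a <= (1 + `|k%:~R|) * (1 + `|k'%:~R|) :> R.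
  move=> /le_trans ak; have kk' : 0 <= `|k%:~R| * `|k'%:~R| :> R by rewrite mulr_ge0.
  have := ak _ (lexx _); nra.
split; rewrite ler_wpM2l ?mulr_ge0 ?exprn_ge0// lerXn2r ?nnegrE ?mulr_ge0 ?addr_ge0//.
- by apply: le; rewrite intrD addrC ler_normD.
- by apply: le; rewrite intrB [leRHS]addrC ler_normB.
Qed.

Hypotheses (J0 : J != 0%N) (wp : chain (weight 6) p S).
Hypotheses (mp : forall N, mean_free (p N)).

Lemma le_bound_weight r s B C (h : nat * int -> R) : (r <= s)%N -> 0 <= B -> B <= C ->
  (forall i, `|h i| <= B * weight r i) -> forall i, `|h i| <= C * weight s i.
Proof.
move=> rs B0 BC hB i; apply: le_trans (hB i) _.
by rewrite ler_pM ?weight_ge0 ?weight_le.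
Qed.

Lemma freq_bound_weight r B (h : nat * int -> R) : 0 <= B ->
  (forall i, `|h i| <= B * weight r i) ->
  forall i, `|freq R J i.2 * h i| <= (J%:R * B) * weight r.+1 i.
Proof.
move=> B0 hB i; rewrite normrM /freq normrM normr_nat -!mulrA ler_wpM2l//.
have -> : B * weight r.+1 i = (1 + `|i.2%:~R|) * (B * weight r i).
  by rewrite /weight exprS; ring.
by apply: ler_pM => //; rewrite lerDr.
Qed.

(** Two derivatives cost two powers of $1 + |k|$, which the weight has to
    provide. *)
Lemma cos_series_deriv2 r B h : (r.+2 <= 6)%N -> 0 <= B ->
  (forall i, `|h i| <= B * weight r i) ->
  zeta_deriv2 (cos_series J h p)
    (cos_series J (fun i => freq R J i.2 * (- freq R J i.2 * h i)) p) /\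
  (forall i, `|freq R J i.2 * (- freq R J i.2 * h i)| <=
     (J%:R * (J%:R * B)) * weight r.+2 i).
Proof.
move=> r6 B0 hB.
have JB0 : 0 <= J%:R * B by rewrite mulr_ge0.
have JJB0 : 0 <= J%:R * (J%:R * B) by rewrite mulr_ge0.
have h1 := freq_bound_weight B0 hB.
have h1' i : `|- freq R J i.2 * h i| <= (J%:R * B) * weight r.+1 i.
  by rewrite mulNr normrN.
have h2 := freq_bound_weight JB0 h1'.
have up s C (f : nat * int -> R) : (s <= 6)%N -> 0 <= C ->
    (forall i, `|f i| <= C * weight s i) -> forall i, `|f i| <= C * weight 6 i.
  by move=> s6 C0; exact: le_bound_weight.
have r1 : (r.+1 <= 6)%N by exact: ltnW.
have r0 : (r <= 6)%N by exact: ltnW.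
split=> //; exists (J%:R * B * S), (sin_series J (fun i => - freq R J i.2 * h i) p).
split.
- exact: profile_sin_series (weight_ge0 6) wp _ _ JB0 (up _ _ _ r1 JB0 h1').
- exact: cos_series_dzeta (weight_ge0 6) wp _ _ _ B0 JB0 (up _ _ _ r0 B0 hB)
    (up _ _ _ r1 JB0 h1).
- exact: sin_series_dzeta (weight_ge0 6) wp _ _ _ JB0 JJB0 (up _ _ _ r1 JB0 h1')
    (up _ _ _ r6 JJB0 h2).
Qed.

(** Six derivatives stay summable along the chain, so the $H^4$ norm is
    controlled by the supremum of the time factor relative to $4^n$. *)
Lemma cos_series_Hnorm (tau : nat -> R) B : 0 <= B ->
  (forall n, `|tau n| <= B * 4 ^+ n) ->
  (Hnorm 4 (zeta_fun (cos_series J (fun i => tau i.1) p)) <=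
    (12 * (J%:R ^+ 6 * B * S))%:E)%E.
Proof.
move=> B0 tauB.
have g0 i : `|tau i.1| <= B * weight 0 i by rewrite /weight mulr1.
have J1 : 1 <= J%:R :> R by rewrite (ler_nat R 1) lt0n.
have JB0 (C : R) : 0 <= C -> 0 <= J%:R * (J%:R * C) by move=> ?; rewrite !mulr_ge0.
have JB1 (C : R) : 0 <= C -> C <= J%:R * (J%:R * C).
  by move=> C0; rewrite mulrA ler_peMl// mulr_ege1.
have [d0 g2] := cos_series_deriv2 (isT : (2 <= 6)%N) B0 g0.
have B2 := JB0 _ B0; have [d2 g4] := cos_series_deriv2 (isT : (4 <= 6)%N) B2 g2.
have B4 := JB0 _ B2; have [d4 g6] := cos_series_deriv2 (isT : (6 <= 6)%N) B4 g4.
have B6 := JB0 _ B4.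
rewrite (_ : J%:R ^+ 6 * B = J%:R * (J%:R * (J%:R * (J%:R * (J%:R * (J%:R * B))))));
  last by ring.
set C6 := J%:R * _.
have C46 := JB1 _ B4; have C26 := le_trans (JB1 _ B2) C46.
have C06 := le_trans (JB1 _ B0) C26.
have P r D h : (r <= 6)%N -> 0 <= D -> D <= C6 ->
    (forall i, `|h i| <= D * weight r i) -> profile (C6 * S) (cos_series J h p).
  move=> r6 D0 D6 hD.
  exact: profile_cos_series (weight_ge0 6) wp _ _ B6 (le_bound_weight r6 D0 D6 hD).
apply: (Hnorm4_le _ _ _ _ d0 d2 d4).
- exact: P g0.
- exact: P g2.
- exact: P g4.
- exact: P g6.
have [_ _ //] := cos_series_L2ev J0 (weight_ge0 6) wp mp B0
  (le_bound_weight (isT : (0 <= 6)%N) B0 (lexx B) g0).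
Qed.

End series_sobolev.

(** * The spectrum of the linearization *)

Section spectrum.
Variable R : realType.

(** The mode $\cos(j \zeta)$ is unstable when $0 < j \kappa < 1$, so $J$ is
    its own only unstable multiple as soon as $1 \le 2 J \kappa$. Restricting
    to multiples of such a $J$ makes the unstable space one-dimensional. The
    smallest $J$ with this property also satisfies $J \kappa < 1$. *)
Lemma exists_single_unstable_mode (kappa : R) : 0 < kappa -> kappa < 1 ->
  exists J : nat, [/\ J != 0%N, J%:R * kappa < 1 & 1 <= 2 * (J%:R * kappa)].
Proof.
move=> k0 k1.
have exJ : exists J : nat, 1 <= 2 * (J%:R * kappa).
  have /archi_boundP := ltW (divr_gt0 (@ltr01 R) k0).
  set J := Num.bound _ => /ltW; rewrite ler_pdivrMr// => J1.
  by exists J; have J0 : 0 <= J%:R :> R by []; nra.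
case: (ex_minnP exJ) => J J1 Jmin; exists J; split => //.
  by apply/eqP => J0; move: J1; rewrite J0 mul0r mulr0 ler10.
case: J J1 Jmin => [|J J1 Jmin]; first by rewrite mul0r.
have [->|J0] := eqVneq J 0%N; first by rewrite mul1r.
have J1R : 1 <= J%:R :> R by rewrite (ler_nat R 1) lt0n.
have Jlt : 2 * (J%:R * kappa) < 1.
  by rewrite ltNge; apply/negP => /Jmin; rewrite ltnn.
rewrite -natr1; nra.
Qed.

(** The eigenvalue of the linearization on $\cos(k J \zeta)$, where $a =
    \gamma m^3$ and $\nu = (\pi J / \ell)^2$. *)
Definition growth_rate (a nu : R) (k : int) : R :=
  a * (nu * k%:~R ^+ 2) * (1 - nu * k%:~R ^+ 2).

Lemma growth_rate1 (a nu : R) : growth_rate a nu 1 = a * nu * (1 - nu).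
Proof. by rewrite /growth_rate; ring. Qed.

Lemma growth_rate1_gt0 (a nu : R) : 0 < a -> 1 <= 4 * nu -> nu < 1 ->
  0 < growth_rate a nu 1.
Proof. by move=> a0 nu0 nu1; rewrite growth_rate1 !mulr_gt0//; lra. Qed.

Lemma sqr_int_cases (k : int) :
  [\/ k%:~R ^+ 2 = 0 :> R, k%:~R ^+ 2 = 1 :> R | 4 <= k%:~R ^+ 2 :> R].
Proof.
have sq : k%:~R ^+ 2 = (`|k|%N%:R) ^+ 2 :> R.
  by rewrite natr_absz intr_norm real_normK ?num_real.
rewrite sq; case: `|k|%N => [|[|n]]; first by constructor 1; rewrite expr0n.
  by constructor 2; rewrite expr1n.
by constructor 3; rewrite -natrX ler_nat -mulnn (@leq_mul 2 2).
Qed.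

Lemma growth_rate_le (a nu : R) k : 0 < a -> 1 <= 4 * nu -> nu < 1 ->
  growth_rate a nu k <= growth_rate a nu 1.
Proof.
move=> a0 nu0 nu1.
rewrite growth_rate1 /growth_rate -[leLHS]mulrA -[leRHS]mulrA ler_pM2l//.
have p : 0 <= nu * (1 - nu) by rewrite mulr_ge0; lra.
have [->|->|k2] := sqr_int_cases k; first by rewrite mulr0 mul0r.
  by rewrite mulr1.
apply: le_trans p; rewrite mulr_ge0_le0//; first by nra.
by rewrite subr_le0; nra.
Qed.

(** There is no resonance at order $n \ge 2$, because $n \omega$ exceeds the
    largest growth rate $\omega$; since growth rates tend to $-\infty$ like
    $-k^4$, inverting $n \omega - \lambda_k$ gains four derivatives. *)
Lemma resolvent_bound (a nu : R) : 0 < a -> 1 <= 4 * nu -> nu < 1 ->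
  exists2 K, 0 < K & forall (n : nat) (k : int),
  (2 <= n)%N ->
  (1 + `|k%:~R|) ^+ 4 <= K * (n%:R * growth_rate a nu 1 - growth_rate a nu k).
Proof.
move=> a0 nu0 nu1.
have om0 := growth_rate1_gt0 a0 nu0 nu1; set om := growth_rate a nu 1 in om0 *.
pose D0 := 1 + a / om.
have D00 : 0 < D0 by rewrite ltr_wpDr// divr_ge0// ltW.
have nu00 : 0 < nu by lra.
exists (4 / nu ^+ 2 * (4 / a * D0)) => [|n k n2].
  by rewrite !mulr_gt0 ?invr_gt0 ?exprn_gt0.
set D := _ - _; pose x := nu * k%:~R ^+ 2.
have x0 : 0 <= x by rewrite mulr_ge0 ?sqr_ge0// ltW.
have n2R : 2 <= n%:R :> R by rewrite (ler_nat R 2).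
have Dom : om <= D.
  by have := growth_rate_le k a0 nu0 nu1; rewrite -/om /D => h; nra.
have Dx : a * (x ^+ 2 - 1) / 2 <= D.
  have h1 : 0 <= a * (x - 1) ^+ 2 by rewrite mulr_ge0 ?sqr_ge0// ltW.
  have h2 : 0 <= n%:R * om by rewrite mulr_ge0// ltW.
  by rewrite /D /growth_rate -/x; lra.
have s1 : (1 + x) ^+ 2 <= 4 / a * D0 * D.
  have aD : a <= a / om * D.
    by rewrite -mulrA ler_peMr ?(ltW a0)// mulrC ler_pdivlMr ?mul1r.
  have : a * (1 + x) ^+ 2 <= 4 * (D0 * D).
    by rewrite /D0 mulrDl mul1r; nra.
  by rewrite mulrC -ler_pdivlMr// => /le_trans -> //; rewrite le_eqVlt; apply/orP; left; apply/eqP; ring.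
have s2 : (1 + `|k%:~R|) ^+ 4 <= 4 / nu ^+ 2 * (1 + x) ^+ 2 :> R.
  set t : R := `|k%:~R|; have t0 : 0 <= t by exact: normr_ge0.
  have xt : x = nu * t ^+ 2 by rewrite /x /t real_normK ?num_real.
  have st : (1 + t) ^+ 2 <= 2 / nu * (1 + x).
    have h : 0 <= nu * (t - 1) ^+ 2 by rewrite mulr_ge0 ?sqr_ge0// ltW.
    by rewrite mulrAC ler_pdivlMr// xt; lra.
  rewrite (_ : (1 + t) ^+ 4 = ((1 + t) ^+ 2) ^+ 2); last by ring.
  rewrite (_ : 4 / nu ^+ 2 * _ = (2 / nu * (1 + x)) ^+ 2); last first.
    by field; rewrite gt_eqF.
  by rewrite lerXn2r ?nnegrE ?sqr_ge0 ?mulr_ge0 ?invr_ge0 ?addr_ge0// ltW.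
by apply: le_trans s2 _; rewrite -[leRHS]mulrA ler_wpM2l// divr_ge0// sqr_ge0.
Qed.

End spectrum.

(** * The formal solution *)

Section picard.
Variables (R : realType) (J : nat) (gamma m kappa : R).
Implicit Types (p q : formal_sum R).

Local Notation a := (gamma * m ^+ 3).
Local Notation nu := ((kappa * J%:R) ^+ 2).
Local Notation omega := (growth_rate a nu 1).
Local Notation lam := (growth_rate a nu).
Local Notation freq := (freq R J).
Local Notation norm r := (wnorm (@weight R r)).

(** The symbol of $\Delta_\ell + 1$. *)
Definition curvature_symbol (i : nat * int) : R := 1 - (kappa * freq i.2) ^+ 2.

(** $(m + u)^3 - m^3$, for the cosine series $u$ of [p]. *)
Definition mobility p : formal_sum R :=
  multiplier (fun=> 3 * m ^+ 2) p ++ multiplier (fun=> 3 * m) (cmul p p) ++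
  cmul p (cmul p p).

(** As a sine series, $- ((m + u)^3 - m^3) \partial_\zeta (\Delta_\ell u +
    u)$. *)
Definition flux p : formal_sum R :=
  cmul (mobility p) (multiplier (fun i => freq i.2 * curvature_symbol i) p).

(** As a cosine series, the nonlinear part of the right-hand side. *)
Definition nonlinearity p : formal_sum R :=
  multiplier (fun i => gamma * kappa ^+ 2 * freq i.2) (flux p).

(** The cutoff excludes the resonant indices $n = 1$, $k = \pm 1$; corrections
    never have degree less than two. *)
Definition resolvent (i : nat * int) : R :=
  if (2 <= i.1)%N then (i.1%:R * omega - lam i.2)^-1 else 0.

Definition seed (eps : R) : formal_sum R := [:: (eps, (1%N, 1))].

(** A formal solution is a fixed point: the seed is annihilated by $n \omega -
    \lambda_k$, and the resolvent inverts this symbol on the nonlinearity. *)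
Definition picard_step eps p :=
  seed eps ++ multiplier resolvent (nonlinearity p).

Definition picard eps N := iter N (picard_step eps) [::].

Lemma subsum_mobility p q : subsum p q -> subsum (mobility p) (mobility q).
Proof.
move=> pq; apply: subsum_cat; first exact: subsum_map.
apply: subsum_cat; first exact/subsum_map/subsum_cmul.
by apply: subsum_cmul => //; exact: subsum_cmul.
Qed.

Lemma subsum_flux p q : subsum p q -> subsum (flux p) (flux q).
Proof.
by move=> pq; apply: subsum_cmul; [exact: subsum_mobility|exact: subsum_map].
Qed.

Lemma subsum_nonlinearity p q :
  subsum p q -> subsum (nonlinearity p) (nonlinearity q).
Proof. by move=> pq; exact/subsum_map/subsum_flux. Qed.

Lemma subsum_picard eps N : subsum (picard eps N) (picard eps N.+1).
Proof.
elim: N => [|N IH]; first exact: subsum0.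
apply: subsum_cat; first exact: subsum_refl.
exact/subsum_map/subsum_nonlinearity.
Qed.

Lemma degree_ge_flux p : degree_ge 1 p -> degree_ge 2 (flux p).
Proof.
move=> dp; apply: (@degree_ge_cmul _ 1 1); last exact: degree_ge_multiplier.
have dp2 := degree_ge_cmul dp dp.
apply: degree_ge_cat; first exact: degree_ge_multiplier.
apply: degree_ge_cat; first by apply: degree_ge_multiplier; exact: degree_geW dp2.
by apply: degree_geW (degree_ge_cmul dp dp2).
Qed.

Lemma degree_ge_nonlinearity p : degree_ge 1 p -> degree_ge 2 (nonlinearity p).
Proof. by move=> dp; exact/degree_ge_multiplier/degree_ge_flux. Qed.

Lemma degree_ge_picard eps N : degree_ge 1 (picard eps N).
Proof.
elim: N => [//|N IH]; apply: degree_ge_cat => //.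
apply: degree_ge_multiplier; exact: degree_geW (degree_ge_nonlinearity IH).
Qed.

Lemma mean_free_picard eps N : mean_free (picard eps N).
Proof.
case: N => [//|N]; rewrite /mean_free all_cat; apply/andP; split => //.
rewrite !all_map; apply/allP => -[c [n k]] _ /=.
by case: eqVneq => [->|//] /=; rewrite freq0 !(mulr0, mul0r) eqxx.
Qed.

Hypotheses (gamma0 : 0 < gamma) (m0 : 0 < m) (kappa0 : 0 < kappa).
Hypotheses (nu_ge : 1 <= 4 * nu) (nu_lt1 : nu < 1).

(** Evaluating the fixed point equation on any symbol: the seed lies in the
    kernel of $n \omega - \lambda_k$, and everything else has degree at least
    two, where this symbol does not vanish. *)
Lemma pairing_picard eps N (f : nat * int -> R) :
  pairing (fun i => (i.1%:R * omega - lam i.2) * f i) (picard eps N.+1) =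
  pairing f (nonlinearity (picard eps N)).
Proof.
rewrite [picard eps N.+1]/= pairing_cat pairing_multiplier.
rewrite [X in X + _](_ : _ = 0) ?add0r; last first.
  by rewrite /pairing big_seq1 /= mul1r subrr mul0r mulr0.
apply: (@eq_pairing_degree _ 2).
  exact/degree_ge_nonlinearity/degree_ge_picard.
move=> [n k] /= n2; rewrite /resolvent /= n2 mulrA mulVf ?mul1r//.
have [K K0 /(_ n k n2)] := resolvent_bound (mulr_gt0 gamma0 (exprn_gt0 3 m0)) nu_ge nu_lt1.
move=> le; apply/eqP => z; move: le; rewrite z mulr0 => /le_lt_trans/(_ ltr01).
by rewrite ltNge exprn_ege1 // lerDl.
Qed.

Lemma norm_mobility p : norm 6 p <= 1 ->
  norm 3 (mobility p) <= (3 * m ^+ 2 + 3 * m + 1) * norm 6 p.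
Proof.
set x := norm 6 p => x1.
have x0 : 0 <= x by apply: wnorm_ge0; exact: weight_ge0.
have x3 : norm 3 p <= x by apply: le_wnorm => i; exact: weight_le.
have x30 : 0 <= norm 3 p by apply: wnorm_ge0; exact: weight_ge0.
have sw := @weight_submultiplicative R 3.
have n2 : norm 3 (cmul p p) <= x.
  by apply: le_trans (wnorm_cmul _ _ sw) _; nra.
have n20 : 0 <= norm 3 (cmul p p) by apply: wnorm_ge0; exact: weight_ge0.
have n3 : norm 3 (cmul p (cmul p p)) <= x.
  by apply: le_trans (wnorm_cmul _ _ sw) _; nra.
have e2 : `|3 * m ^+ 2| = 3 * m ^+ 2 by rewrite ger0_norm// mulr_ge0// sqr_ge0.
have e1 : `|3 * m| = 3 * m by rewrite ger0_norm// mulr_ge0// ltW.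
rewrite /mobility 2!wnorm_cat 2!wnorm_multiplier 2!wnormZ e2 e1.
have m2 : 3 * m ^+ 2 * norm 3 p <= 3 * m ^+ 2 * x.
  by rewrite ler_wpM2l// mulr_ge0// sqr_ge0.
have m1 : 3 * m * norm 3 (cmul p p) <= 3 * m * x.
  by rewrite ler_wpM2l// mulr_ge0// ltW.
lra.
Qed.

Lemma norm_flux : exists2 K, 0 < K & forall p, norm 6 p <= 1 ->
  norm 3 (flux p) <= K * norm 6 p ^+ 2.
Proof.
pose A : R := J%:R + kappa ^+ 2 * J%:R ^+ 3.
have A0 : 0 <= A by rewrite addr_ge0// mulr_ge0 ?sqr_ge0// exprn_ge0.
have c0 : 0 < 3 * m ^+ 2 + 3 * m + 1 by have := sqr_ge0 m; have := m0; lra.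
exists ((3 * m ^+ 2 + 3 * m + 1) * (1 + A)) => [|p p1].
  by rewrite mulr_gt0//; lra.
set x := norm 6 p; have x0 : 0 <= x by apply: wnorm_ge0; exact: weight_ge0.
apply: le_trans (wnorm_cmul _ _ (@weight_submultiplicative R 3)) _.
rewrite (_ : _ * x ^+ 2 = ((3 * m ^+ 2 + 3 * m + 1) * x) * ((1 + A) * x)); last by ring.
apply: ler_pM; try by apply: wnorm_ge0; exact: weight_ge0.
  exact: norm_mobility.
rewrite wnorm_multiplier -wnormZ; apply: le_wnorm => i.
rewrite /weight (_ : 6 = 3 + 3)%N // exprD.
set t := 1 + _; have t1 : 1 <= t by rewrite lerDl.
have ft : `|freq i.2| <= J%:R * t.
  by rewrite normrM normr_nat ler_wpM2l// lerDr.
have t3 : t <= t ^+ 3 by rewrite exprS ler_peMr ?exprn_ege1//; lra.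
have f0 : 0 <= `|freq i.2| by [].
suff sf : `|freq i.2 * curvature_symbol i| <= (1 + A) * t ^+ 3.
  rewrite mulrCA [leRHS]mulrCA ler_wpM2l ?exprn_ge0// [leRHS]mulrA.
  by rewrite ler_wpM2r// exprn_ge0//; lra.
have -> : freq i.2 * curvature_symbol i = freq i.2 - kappa ^+ 2 * freq i.2 ^+ 3.
  by rewrite /curvature_symbol; ring.
apply: le_trans (ler_normB _ _) _; rewrite [`|kappa ^+ 2 * _|]normrM !normrX (ger0_norm (ltW kappa0)).
have f3 : `|freq i.2| ^+ 3 <= J%:R ^+ 3 * t ^+ 3.
  by rewrite -exprMn lerXn2r ?nnegrE ?mulr_ge0//; lra.
have k2 : kappa ^+ 2 * `|freq i.2| ^+ 3 <= kappa ^+ 2 * (J%:R ^+ 3 * t ^+ 3).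
  by rewrite ler_wpM2l ?sqr_ge0.
have Jt : J%:R * t <= J%:R * t ^+ 3 by rewrite ler_wpM2l.
have t30 : 0 <= t ^+ 3 by rewrite exprn_ge0//; lra.
rewrite mulrDl mul1r /A mulrDl; lra.
Qed.

(** The flux costs three derivatives and the divergence one; the resolvent
    recovers all four. *)
Lemma norm_correction : exists2 K, 0 < K & forall p, norm 6 p <= 1 ->
  norm 6 (multiplier resolvent (nonlinearity p)) <= K * norm 6 p ^+ 2.
Proof.
have a0 := mulr_gt0 gamma0 (exprn_gt0 3 m0).
have [K K0 leK] := resolvent_bound a0 nu_ge nu_lt1.
have [L L0 leL] := norm_flux.
pose A := K * (gamma * kappa ^+ 2 * J%:R) + 1.
have A0 : 0 < A.
  by rewrite ltr_wpDl// !mulr_ge0 ?sqr_ge0// ltW.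
exists (A * L) => [|p p1]; first by rewrite mulr_gt0.
rewrite -mulrA; apply: le_trans (ler_wpM2l (ltW A0) (leL _ p1)).
rewrite !wnorm_multiplier -wnormZ; apply: le_wnorm => -[n k].
rewrite /resolvent /=; case: ifPn => [n2|_]; last first.
  by rewrite normr0 mul0r mulr0 mulr_ge0 ?weight_ge0 ?(ltW A0).
have := leK n k n2; set t := 1 + _; set D := _ - _ => tD.
have t1 : 1 <= t by rewrite lerDl.
have t0 : 0 < t by lra.
have D0 : 0 < D.
  by rewrite -(pmulr_rgt0 _ K0); apply: lt_le_trans tD; rewrite exprn_gt0.
have Dt : D^-1 * t ^+ 4 <= K by rewrite mulrC ler_pdivrMr.
have gk0 : 0 <= gamma * kappa ^+ 2 by rewrite mulr_ge0 ?sqr_ge0// ltW.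
rewrite (ger0_norm (_ : 0 <= D^-1)) ?invr_ge0 ?(ltW D0)//.
rewrite normrM (ger0_norm gk0) normrM normr_nat /weight /= -/t.
have kt : `|k%:~R| <= t :> R by rewrite lerDr.
rewrite (_ : _ * (D^-1 * _) =
  (gamma * kappa ^+ 2 * J%:R) * 4 ^+ n * t ^+ 2 * (`|k%:~R| * (D^-1 * t ^+ 4)));
  last by ring.
rewrite (_ : A * _ = (gamma * kappa ^+ 2 * J%:R) * 4 ^+ n * t ^+ 2 * (t * K) +
  4 ^+ n * t ^+ 3); last by rewrite /A; ring.
apply: ler_wpDr; first by rewrite mulr_ge0 ?exprn_ge0// ltW.
rewrite ler_wpM2l ?mulr_ge0 ?exprn_ge0 ?(ltW t0) ?(ltW gamma0) ?(ltW kappa0)//.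
by rewrite ler_pM// mulr_ge0 ?invr_ge0 ?exprn_ge0 ?ltW.
Qed.

Lemma norm_seed (eps : R) : 0 <= eps ->
  norm 6 (seed eps) = eps * weight R 6 (1%N, 1).
Proof. by move=> e0; rewrite /wnorm big_seq1 ger0_norm. Qed.

(** The correction is quadratic in the iterate, so a small seed keeps all
    iterates in a ball and the corrections small with respect to the seed. *)
Lemma small_seed : exists2 eps, 0 < eps & forall N,
  norm 6 (picard eps N) <= 1 /\
  norm 6 (multiplier resolvent (nonlinearity (picard eps N))) <= eps / 4.
Proof.
have [K K0 leK] := norm_correction.
have W1 : 1 <= weight R 6 (1%N, 1).
  by rewrite mulr_ege1// exprn_ege1// ?lerDl// (ler_nat R 1).
have seedE := norm_seed; move: (weight R 6 _) W1 seedE => W W1 seedE.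
have D0 : 0 < 2 * W + K * (4 * W) ^+ 2.
  have : 0 <= K * (4 * W) ^+ 2 by rewrite mulr_ge0 ?sqr_ge0// ltW.
  lra.
(* The first summand makes [2 * W * eps] at most [1], the second one makes
   [K * (2 * W * eps) ^+ 2] at most [eps / 4]. *)
pose eps := (2 * W + K * (4 * W) ^+ 2)^-1; have e0 : 0 < eps by rewrite invr_gt0.
have e1 : 2 * W * eps + K * (4 * W) ^+ 2 * eps = 1.
  by rewrite -mulrDl mulfV// gt_eqF.
have We0 : 0 <= W * eps by rewrite mulr_ge0; lra.
have Ke0 : 0 <= K * (4 * W) ^+ 2 * eps.
  by rewrite mulr_ge0 ?(ltW e0)// mulr_ge0 ?sqr_ge0 ?(ltW K0).
exists eps => // N.
have small p : norm 6 p <= 2 * (W * eps) ->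
    norm 6 p <= 1 /\ norm 6 (multiplier resolvent (nonlinearity p)) <= eps / 4.
  set x := norm 6 p => xe.
  have x0 : 0 <= x by apply: wnorm_ge0; exact: weight_ge0.
  have x1 : x <= 1 by lra.
  split=> //; apply: le_trans (leK _ x1) _; rewrite -/x.
  apply: le_trans (_ : K * (2 * (W * eps)) ^+ 2 <= _).
    by rewrite ler_wpM2l ?(ltW K0)// lerXn2r ?nnegrE// mulr_ge0.
  rewrite (_ : K * (2 * (W * eps)) ^+ 2 = (K * (4 * W) ^+ 2 * eps) * (eps / 4)).
    by apply: ler_piMl; lra.
  by field.
suff : norm 6 (picard eps N) <= 2 * (W * eps) by exact: small.
elim: N => [|N /small[_ c]]; first by rewrite /wnorm big_nil mulr_ge0.
rewrite [picard eps N.+1]/= wnorm_cat seedE ?(ltW e0)//.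
have : eps <= W * eps by rewrite ler_peMl ?(ltW e0).
by move: c; rewrite -/(picard eps N); lra.
Qed.

End picard.

(** * The limit solves the equation *)

Section symbols.
Variables (R : realType) (J : nat).
Implicit Types (g h : nat * int -> R).

(** Symbols of order [r] applied to a chain with weight [r] give convergent
    series. *)
Definition symbol r g := exists2 C, 0 <= C & forall i, `|g i| <= C * weight R r i.

Lemma symbol_le r s g : (r <= s)%N -> symbol r g -> symbol s g.
Proof.
by move=> rs [C C0 gC]; exists C => //; exact: le_bound_weight gC.
Qed.

Lemma symbol_freq r g : symbol r g -> symbol r.+1 (fun i => freq R J i.2 * g i).
Proof.
move=> [C C0 gC]; exists (J%:R * C); first by rewrite mulr_ge0.
exact: freq_bound_weight.
Qed.

Lemma symbolD r g h : symbol r g -> symbol r h -> symbol r (fun i => g i + h i).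
Proof.
move=> [C C0 gC] [D D0 hD]; exists (C + D) => [|i]; first exact: addr_ge0.
by rewrite mulrDl (le_trans (ler_normD _ _))// lerD.
Qed.

Lemma symbolZ c r g : symbol r g -> symbol r (fun i => c * g i).
Proof.
move=> [C C0 gC]; exists (`|c| * C) => [|i]; first exact: mulr_ge0.
by rewrite normrM -mulrA ler_wpM2l.
Qed.

Lemma eq_symbol r g h : g =1 h -> symbol r g -> symbol r h.
Proof. by move=> /funext ->. Qed.

Lemma symbol_freqN r g :
  symbol r g -> symbol r.+1 (fun i => - freq R J i.2 * g i).
Proof.
by move=> /symbol_freq /(symbolZ (-1)); apply: eq_symbol => i; rewrite mulN1r mulNr.
Qed.

Variables (r : nat) (p : nat -> formal_sum R) (S : R).
Hypothesis wp : chain (weight R r) p S.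
Local Notation w0 := (@weight_ge0 R r).

Lemma symbol_cos_cvg g y : symbol r g ->
  (fun N => cos_sum J g (p N) y) @ \oo --> cos_series J g p y.
Proof. by move=> [C C0 gC]; exact: (cos_series_cvg w0 wp C0 gC). Qed.

Lemma symbol_sin_cvg g y : symbol r g ->
  (fun N => sin_sum J g (p N) y) @ \oo --> sin_series J g p y.
Proof. by move=> [C C0 gC]; exact: (sin_series_cvg w0 wp C0 gC). Qed.

Lemma symbol_cos_profile g : symbol r g ->
  exists B, profile B (cos_series J g p).
Proof.
by move=> [C C0 gC]; exists (C * S); exact: (profile_cos_series J w0 wp C0 gC).
Qed.

Lemma symbol_cos_dzeta s g : (s < r)%N -> symbol s g ->
  is_dzeta (zeta_fun (cos_series J g p))
    (zeta_fun (sin_series J (fun i => - freq R J i.2 * g i) p)).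
Proof.
move=> sr sg; have [C C0 gC] := symbol_le (ltnW sr) sg.
have [D D0 gD] := symbol_le sr (symbol_freq sg).
exact: (cos_series_dzeta w0 wp C0 D0 gC gD).
Qed.

Lemma symbol_sin_dzeta s g : (s < r)%N -> symbol s g ->
  is_dzeta (zeta_fun (sin_series J g p))
    (zeta_fun (cos_series J (fun i => freq R J i.2 * g i) p)).
Proof.
move=> sr sg; have [C C0 gC] := symbol_le (ltnW sr) sg.
have [D D0 gD] := symbol_le sr (symbol_freq sg).
exact: (sin_series_dzeta w0 wp C0 D0 gC gD).
Qed.

Lemma symbol_cos_lin a b g h y : symbol r g -> symbol r h ->
  cos_series J (fun i => a * g i + b * h i) p y =
  a * cos_series J g p y + b * cos_series J h p y.
Proof.
by move=> [C C0 gC] [D D0 hD]; exact: (cos_seriesD J w0 wp a b y C0 D0 gC hD).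
Qed.

Lemma symbol_cosZ c g h y : symbol r g -> (forall i, h i = c * g i) ->
  cos_series J h p y = c * cos_series J g p y.
Proof.
move=> sg /funext ->; apply: cvg_lim => //.
have -> : (fun N => pairing (fun i => c * g i * cos (freq R J i.2 * y)) (p N)) =
    fun N => c * cos_sum J g (p N) y.
  apply/funext => N; rewrite /cos_sum /pairing mulr_sumr.
  by apply: eq_bigr => x _; ring.
by apply: cvgM; [exact: cvg_cst|exact: symbol_cos_cvg].
Qed.

Lemma symbol_sinZ c g h y : symbol r g -> (forall i, h i = c * g i) ->
  sin_series J h p y = c * sin_series J g p y.
Proof.
move=> sg /funext ->; apply: cvg_lim => //.
have -> : (fun N => pairing (fun i => c * g i * sin (freq R J i.2 * y)) (p N)) =
    fun N => c * sin_sum J g (p N) y.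
  apply/funext => N; rewrite /sin_sum /pairing mulr_sumr.
  by apply: eq_bigr => x _; ring.
by apply: cvgM; [exact: cvg_cst|exact: symbol_sin_cvg].
Qed.

End symbols.

Section solves.
Variables (R : realType) (J : nat) (gamma m ell eps : R).
Local Notation kappa := (pi / ell).
Local Notation a := (gamma * m ^+ 3).
Local Notation nu := ((kappa * J%:R) ^+ 2).
Local Notation omega := (growth_rate a nu 1).
Local Notation lam := (growth_rate a nu).
Local Notation norm r := (wnorm (@weight R r)).
Local Notation P := (picard J gamma m kappa eps).
Local Notation Q := (fun N => flux J m kappa (P N)).
Local Notation curv := (curvature_symbol J kappa).

Hypotheses (gamma0 : 0 < gamma) (m0 : 0 < m) (kappa0 : 0 < kappa).
Hypotheses (nu_ge : 1 <= 4 * nu) (nu_lt1 : nu < 1).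
Hypothesis small : forall N, norm 6 (P N) <= 1.

Lemma chain_picard r : (r <= 6)%N -> chain (weight R r) P 1.
Proof.
move=> r6; split=> N; first exact: subsum_picard.
by apply: le_trans (small N); apply: le_wnorm => i; exact: weight_le.
Qed.

Lemma chain_flux : exists S, chain (weight R 3) Q S.
Proof.
have [K K0 leK] := norm_flux J m0 kappa0.
exists K; split=> N; first exact/subsum_flux/subsum_picard.
apply: le_trans (leK _ (small N)) _; rewrite ler_piMr ?(ltW K0)//.
by rewrite expr_le1// wnorm_ge0// => i; exact: weight_ge0.
Qed.

Variable tau : nat -> R.
Hypothesis tauM : forall n n', tau (n + n')%N = tau n * tau n'.
Hypothesis tau1 : forall n, `|tau n| <= 1.
Local Notation T := (fun i : nat * int => tau i.1).

Lemma symbol_tau : symbol 0 T.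
Proof.
exists 1 => // i; rewrite mul1r /weight expr0 mulr1 (le_trans (tau1 _))//.
by rewrite exprn_ege1// (ler_nat R 1).
Qed.

Lemma symbol_degree_tau : symbol 0 (fun i => i.1%:R * tau i.1).
Proof.
exists 1 => // i; rewrite mul1r /weight expr0 mulr1 normrM normr_nat.
apply: le_trans (_ : i.1%:R * 1 <= _); first by rewrite ler_wpM2l.
by rewrite mulr1 -natrX ler_nat ltnW// ltn_expl.
Qed.

Local Notation D1 g := (fun i => - freq R J i.2 * g i).
Local Notation D2 g := (fun i => freq R J i.2 * (- freq R J i.2 * g i)).
Local Notation curvT := (fun i => curv i * tau i.1).

Lemma curvTE i : curvT i = 1 * tau i.1 + kappa ^+ 2 * D2 T i.
Proof. by rewrite /curvature_symbol; ring. Qed.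

Lemma symbol_curvT : symbol 2 curvT.
Proof.
have s2 := symbolZ (kappa ^+ 2) (symbol_freq J (symbol_freqN J symbol_tau)).
have s0 := symbolZ 1 (symbol_le (isT : (0 <= 2)%N) symbol_tau).
by apply: eq_symbol (symbolD s0 s2) => i; rewrite curvTE.
Qed.

(** The limit of [pairing_picard] along the iteration, for the symbols
    $\tau(n) \cos(k J y)$. *)
Lemma cos_series_evolution y :
  omega * cos_series J (fun i => i.1%:R * tau i.1) P y =
  - a * (kappa ^+ 2 * cos_series J (D2 curvT) P y) +
  gamma * kappa ^+ 2 * cos_series J (fun i => freq R J i.2 * tau i.1) Q y.
Proof.
have [SQ wQ] := chain_flux; have wP := chain_picard (leqnn 6).
have sD2 : symbol 6 (D2 curvT).
  by apply: symbol_le (symbol_freq J (symbol_freqN J symbol_curvT)).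
have sdeg : symbol 6 (fun i => i.1%:R * tau i.1) by exact: symbol_le symbol_degree_tau.
have sf : symbol 3 (fun i => freq R J i.2 * tau i.1).
  exact: symbol_le (symbol_freq J symbol_tau).
suff : omega * cos_series J (fun i => i.1%:R * tau i.1) P y +
   a * kappa ^+ 2 * cos_series J (D2 curvT) P y =
   gamma * kappa ^+ 2 * cos_series J (fun i => freq R J i.2 * tau i.1) Q y.
  by move=> <-; ring.
rewrite -(symbol_cos_lin J wP _ _ _ sdeg sD2).
have sL : symbol 6 (fun i => omega * (i.1%:R * tau i.1) + a * kappa ^+ 2 * D2 curvT i).
  by apply: symbolD; exact: symbolZ.
have cL := @symbol_cos_cvg _ J _ _ _ wP _ y sL.
have cR : (fun N => gamma * kappa ^+ 2 * cos_sum J (fun i => freq R J i.2 * tau i.1) (Q N) y)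
    @ \oo --> gamma * kappa ^+ 2 * cos_series J (fun i => freq R J i.2 * tau i.1) Q y.
  by apply: cvgM; [exact: cvg_cst|exact: (@symbol_cos_cvg _ J _ _ _ wQ _ y sf)].
have E N : cos_sum J (fun i => omega * (i.1%:R * tau i.1) + a * kappa ^+ 2 * D2 curvT i) (P N.+1) y =
    gamma * kappa ^+ 2 * cos_sum J (fun i => freq R J i.2 * tau i.1) (Q N) y.
  have /= := pairing_picard gamma0 m0 nu_ge nu_lt1 eps N (fun i => tau i.1 * cos (freq R J i.2 * y)).
  rewrite [in RHS]/nonlinearity pairing_multiplier => h.
  transitivity (pairing (fun i => gamma * kappa ^+ 2 * freq R J i.2 *
    (tau i.1 * cos (freq R J i.2 * y))) (Q N)).
    rewrite -h; apply: eq_bigr => x _; congr (_ * _).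
    rewrite /growth_rate /curvature_symbol /freq; ring.
  rewrite /cos_sum /pairing mulr_sumr; apply: eq_bigr => x _; ring.
apply: (cvg_unique (@Rhausdorff R) _ cR).
rewrite -(funext E).
by move: cL; rewrite -cvg_shiftS.
Qed.

Lemma cos_sum_mobility (p : formal_sum R) y :
  cos_sum J T (mobility m p) y = 3 * m ^+ 2 * cos_sum J T p y +
    3 * m * cos_sum J T p y ^+ 2 + cos_sum J T p y ^+ 3.
Proof.
have cE c q : cos_sum J T (multiplier (fun=> c) q) y = c * cos_sum J T q y.
  rewrite /cos_sum pairing_multiplier /pairing mulr_sumr.
  by apply: eq_bigr => x _; ring.
rewrite {1}/cos_sum /mobility 2!pairing_cat -!/(cos_sum J T _ y) !cE.
by rewrite !(cos_sum_cmul J tauM); ring.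
Qed.

Local Notation u := (cos_series J T P).

Lemma sin_series_flux y : sin_series J T Q y =
  (3 * m ^+ 2 * u y + 3 * m * u y ^+ 2 + u y ^+ 3) *
  sin_series J (fun i => freq R J i.2 * curvT i) P y.
Proof.
have wP := chain_picard (leqnn 6).
have cu : (fun N => cos_sum J T (P N) y) @ \oo --> u y.
  apply: (@symbol_cos_cvg _ J _ _ _ wP _ y); exact: symbol_le symbol_tau.
have cs : (fun N => sin_sum J (fun i => freq R J i.2 * curvT i) (P N) y) @ \oo -->
    sin_series J (fun i => freq R J i.2 * curvT i) P y.
  apply: (@symbol_sin_cvg _ J _ _ _ wP _ y).
  exact: symbol_le (symbol_freq J symbol_curvT).
apply: cvg_lim => //.
rewrite (_ : (fun N => _) = fun N => (3 * m ^+ 2 * cos_sum J T (P N) y +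
    3 * m * cos_sum J T (P N) y ^+ 2 + cos_sum J T (P N) y ^+ 3) *
    sin_sum J (fun i => freq R J i.2 * curvT i) (P N) y).
  apply: cvgM cs; apply: cvgD; first apply: cvgD.
  - by apply: cvgM cu; exact: cvg_cst.
  - by apply: cvgM; [exact: cvg_cst|exact: (cvgM cu cu)].
  - exact: (cvgM cu (cvgM cu cu)).
apply/funext => N; rewrite -cos_sum_mobility -/(sin_sum J T _ y).
rewrite /flux (sin_sum_cmul J tauM); congr (_ * _).
by rewrite /sin_sum pairing_multiplier; apply: eq_bigr => x _; ring.
Qed.

Lemma zeta_fun0_dtheta : is_dtheta (fun _ : R * R => 0 : R) (fun=> 0).
Proof. exact: profile_weak_dtheta (profile0 R). Qed.

Lemma limit_is_rhs : is_rhs gamma m ell (zeta_fun u)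
  (zeta_fun (fun y => omega * cos_series J (fun i => i.1%:R * tau i.1) P y)).
Proof.
have wP := chain_picard (leqnn 6); have [SQ wQ] := chain_flux.
have sT := symbol_tau; have sT1 := symbol_freqN J sT; have sT2 := symbol_freq J sT1.
have sc := symbol_curvT; have sc1 := symbol_freqN J sc; have sc2 := symbol_freq J sc1.
have [Bu pu] := symbol_cos_profile J wP (symbol_le (isT : (0 <= 6)%N) sT).
have [Bc pc] := symbol_cos_profile J wP (symbol_le (isT : (2 <= 6)%N) sc).
pose lap := fun x : R * R => 0 + pi ^+ 2 / ell ^+ 2 * zeta_fun (cos_series J (D2 T) P) x.
pose lap2 := fun x : R * R =>
  0 + pi ^+ 2 / ell ^+ 2 * zeta_fun (cos_series J (D2 curvT) P) x.
pose g2 := fun x : R * R => pi / ell * zeta_fun (sin_series J (D1 curvT) P) x.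
pose b := cos_series J (fun i => freq R J i.2 * (- kappa * T i)) Q.
exists lap, lap2, (fun=> 0), g2, (fun x => 0 + pi / ell * zeta_fun b x).
have lapE : (fun x => lap x + zeta_fun u x) = zeta_fun (cos_series J curvT P).
  apply/funext => x; rewrite /lap /zeta_fun.
  have -> : curvT = fun i => 1 * T i + kappa ^+ 2 * D2 T i.
    by apply/funext => i; exact: curvTE.
  rewrite (symbol_cos_lin J wP _ _ _ (symbol_le _ sT) (symbol_le _ sT2))//.
  by rewrite -expr_div_n; ring.
rewrite /= lapE; split.
- exists (fun=> 0), (fun=> 0), (zeta_fun (sin_series J (D1 T) P)),
    (zeta_fun (cos_series J (D2 T) P)); split => //.
  + exact: profile_weak_dtheta pu.
  + exact: zeta_fun0_dtheta.
  + by apply: (symbol_cos_dzeta J wP _ sT).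
  + by apply: (symbol_sin_dzeta J wP _ sT1).
- exists (fun=> 0), (fun=> 0), (zeta_fun (sin_series J (D1 curvT) P)),
    (zeta_fun (cos_series J (D2 curvT) P)); split => //.
  + exact: profile_weak_dtheta pc.
  + exact: zeta_fun0_dtheta.
  + by apply: (symbol_cos_dzeta J wP _ sc).
  + by apply: (symbol_sin_dzeta J wP _ sc1).
- exists (zeta_fun (sin_series J (D1 curvT) P)); split => //.
  + exact: profile_weak_dtheta pc.
  + by apply: (symbol_cos_dzeta J wP _ sc).
- exists (fun=> 0), (zeta_fun b); split => //.
  + under eq_fun do rewrite mulr0; exact: zeta_fun0_dtheta.
  + have sk : symbol 0 (fun i => - kappa * T i) by exact: symbolZ.
    have := @symbol_sin_dzeta _ J 3 _ _ wQ _ _ (isT : (0 < 3)%N) sk.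
    congr (is_dzeta _ _); apply/funext => x; rewrite /zeta_fun /g2.
    rewrite (symbol_sinZ J (c := - kappa) wQ _ (symbol_le _ sT))// sin_series_flux.
    rewrite /zeta_fun (symbol_sinZ J (c := -1) (h := D1 curvT) wP _
      (symbol_le _ (symbol_freq J sc)))//; last by move=> i; ring.
    by ring.
apply/aeW => x; rewrite /zeta_fun cos_series_evolution /lap2 -expr_div_n /zeta_fun.
rewrite /b (symbol_cosZ J (c := - kappa) (h := fun i => freq R J i.2 * (- kappa * T i))
  wQ _ (symbol_le _ (symbol_freq J sT)))//; last by move=> i; ring.
by ring.
Qed.

End solves.

(** * Time regularity and conclusion *)

Section exponentials.
Variable R : realType.

Lemma expR_lipschitz_neg (a b : R) : a <= 0 -> b <= 0 ->
  `|expR a - expR b| <= `|a - b|.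
Proof.
wlog ba : a b / b <= a.
  move=> H a0 b0; have [ba|/ltW ab] := leP b a; first exact: H.
  by rewrite distrC (distrC a); exact: H.
move=> a0 _; rewrite !ger0_norm ?subr_ge0 ?ler_expR//.
have -> : expR b = expR a * expR (b - a) by rewrite -expRD addrC subrK.
have e1 : expR a <= 1 by rewrite -expR0 ler_expR.
have e0 : 0 <= expR a by exact: expR_ge0.
have := expR_ge1Dx (b - a); nra.
Qed.

(** The remainder is nonnegative by $1 + d \le e^d$; by $1 - d \le e^{-d}$ it
    is at most $d (e^{a + d} - e^a)$, to which the Lipschitz bound applies. *)
Lemma expR_taylor_neg (a d : R) : a <= 0 -> a + d <= 0 ->
  `|expR (a + d) - expR a - d * expR a| <= d ^+ 2.
Proof.
move=> a0 ad0.
have e0 : 0 <= expR a by exact: expR_ge0.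
have lower : 0 <= expR (a + d) - expR a - d * expR a.
  by rewrite expRD; have := expR_ge1Dx d; nra.
rewrite ger0_norm//.
apply: le_trans (_ : d * (expR (a + d) - expR a) <= _).
  have := expR_ge1Dx (- d); rewrite -(ler_pM2l (expR_gt0 (a + d))).
  by rewrite -expRD addrK; lra.
apply: le_trans (ler_norm _) _; rewrite normrM -real_normK ?num_real// expr2.
rewrite ler_wpM2l//; apply: le_trans (expR_lipschitz_neg ad0 a0) _.
by rewrite addrAC subrr add0r.
Qed.

Lemma degree_le_exp4 (n : nat) : n%:R <= 4 ^+ n :> R /\ n%:R ^+ 2 <= 4 ^+ n :> R.
Proof.
have n2 : n%:R <= 2 ^+ n :> R by rewrite -natrX ler_nat ltnW// ltn_expl.
have e4 : 4 ^+ n = (2 ^+ n) ^+ 2 :> R by rewrite -exprM mulnC exprM; congr (_ ^+ _); ring.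
have n4 : n%:R ^+ 2 <= 4 ^+ n :> R by rewrite e4 lerXn2r ?nnegrE// exprn_ge0.
split=> //; apply: le_trans n4; rewrite -natrX ler_nat -mulnn.
by case: (n) => // k; rewrite leq_pmull.
Qed.

Lemma squeeze_ereal0 (F : set_system R) (f : R -> \bar R) (g : R -> R) :
  Filter F -> (forall s, (0 <= f s)%E) -> (\forall s \near F, (f s <= (g s)%:E)%E) ->
  g @ F --> 0 -> f @ F --> 0%E.
Proof.
move=> FF f0 fg g0; apply: (@squeeze_cvge _ F _ _ (cst 0%E) f (EFin \o g)).
- by apply: filterS fg => s fgs; rewrite f0.
- exact: cvg_cst.
- by apply/fine_cvgP; split => //; exact: nearW.
Qed.

Lemma linear_bound_cvg0 (F : set_system R) (t C : R) :
  Filter F -> F --> t -> (fun s => C * `|s - t|) @ F --> 0.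
Proof.
move=> FF Ft; have -> : 0 = C * `|t - t| by rewrite subrr normr0 mulr0.
apply: cvgM; first exact: cvg_cst.
by apply: cvg_norm; apply: cvgB; [exact: Ft|exact: cvg_cst].
Qed.

End exponentials.

Section backward.
Variables (R : realType) (J : nat) (gamma m ell eps : R).
Local Notation mu := (torus_measure R).
Local Notation kappa := (pi / ell).
Local Notation a := (gamma * m ^+ 3).
Local Notation nu := ((kappa * J%:R) ^+ 2).
Local Notation omega := (growth_rate a nu 1).
Local Notation norm r := (wnorm (@weight R r)).
Local Notation P := (picard J gamma m kappa eps).

Hypotheses (gamma0 : 0 < gamma) (m0 : 0 < m) (kappa0 : 0 < kappa) (J0 : J != 0%N).
Hypotheses (nu_ge : 1 <= 4 * nu) (nu_lt1 : nu < 1) (eps0 : 0 < eps).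
Hypothesis small : forall N, norm 6 (P N) <= 1.
Hypothesis small_correction : forall N,
  norm 6 (multiplier (resolvent J gamma m kappa)
    (nonlinearity J gamma m kappa (P N))) <= eps / 4.

Let wP : chain (weight R 6) P 1 := chain_picard small (leqnn 6).

Definition mode_factor (t : R) (n : nat) : R := expR (n%:R * (omega * t)).

Definition backward (t : R) : R * R -> R :=
  zeta_fun (cos_series J (fun i => mode_factor t i.1) P).

Definition backward_dt (t : R) : R * R -> R :=
  zeta_fun (fun y =>
    omega * cos_series J (fun i => i.1%:R * mode_factor t i.1) P y).

Let omega0 : 0 < omega.
Proof. by apply: growth_rate1_gt0 => //; rewrite mulr_gt0// exprn_gt0. Qed.

Lemma mode_factorM t n n' :
  mode_factor t (n + n') = mode_factor t n * mode_factor t n'.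
Proof. by rewrite /mode_factor natrD mulrDl expRD. Qed.

Lemma mode_exponent_le0 t n : t <= 0 -> n%:R * (omega * t) <= 0.
Proof. by move=> t0; rewrite mulr_ge0_le0// mulr_ge0_le0// ltW. Qed.

Lemma mode_factor_le1 t n : t <= 0 -> `|mode_factor t n| <= 1.
Proof.
move=> t0; rewrite ger0_norm ?expR_ge0// -expR0 ler_expR.
exact: mode_exponent_le0.
Qed.

Lemma mode_factor_lipschitz s t n : s <= 0 -> t <= 0 ->
  `|mode_factor s n - mode_factor t n| <= n%:R * (omega * `|s - t|).
Proof.
move=> s0 t0; apply: le_trans (expR_lipschitz_neg _ _) _.
- exact: mode_exponent_le0.
- exact: mode_exponent_le0.
by rewrite -mulrBr normrM normr_nat -mulrBr (normrM omega) (gtr0_norm omega0).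
Qed.

(** All estimates in time come from applying the same series to the sequence
    $\tau(n) = e^{n \omega t}$, to its increments and to its Taylor
    remainders: each of them is bounded by a constant times $4^n$. *)
Definition time_bound (tau : nat -> R) B := forall n, `|tau n| <= B * 4 ^+ n.

Lemma time_bound_weight tau B : time_bound tau B ->
  forall i : nat * int, `|tau i.1| <= B * weight R 0 i.
Proof. by move=> tB i; rewrite /weight mulr1. Qed.

Lemma series_profile tau B : 0 <= B -> time_bound tau B ->
  profile B (cos_series J (fun i => tau i.1) P).
Proof.
move=> B0 /time_bound_weight tB; rewrite -[B]mulr1.
exact: (profile_cos_series J (@weight_ge0 R 0) (chain_picard small (isT : (0 <= 6)%N)) B0 tB).
Qed.

Lemma series_Hnorm tau B : 0 <= B -> time_bound tau B ->
  (Hnorm 4 (zeta_fun (cos_series J (fun i => tau i.1) P)) <=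
     (12 * J%:R ^+ 6 * B)%:E)%E.
Proof.
move=> B0 tB; have := cos_series_Hnorm J0 wP (mean_free_picard J gamma m kappa eps) B0 tB.
by rewrite mulr1 mulrA.
Qed.

Lemma series_L2ev tau B : 0 <= B -> time_bound tau B ->
  L2ev (zeta_fun (cos_series J (fun i => tau i.1) P)).
Proof.
move=> B0 /time_bound_weight tB.
exact: (cos_series_L2ev J0 (@weight_ge0 R 0) (chain_picard small (isT : (0 <= 6)%N))
  (mean_free_picard J gamma m kappa eps) B0 tB).
Qed.

Lemma seriesD c d sigma tau B y : 0 <= B -> time_bound sigma B -> time_bound tau B ->
  cos_series J (fun i => c * sigma i.1 + d * tau i.1) P y =
  c * cos_series J (fun i => sigma i.1) P y + d * cos_series J (fun i => tau i.1) P y.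
Proof.
move=> B0 /time_bound_weight sB /time_bound_weight tB.
exact: (cos_seriesD J (@weight_ge0 R 0) (chain_picard small (isT : (0 <= 6)%N)) c d y B0 B0 sB tB).
Qed.

Lemma time_bound_mode t : t <= 0 -> time_bound (mode_factor t) 1.
Proof.
move=> t0 n; rewrite mul1r (le_trans (mode_factor_le1 n t0))//.
by rewrite exprn_ege1// (ler_nat R 1).
Qed.

Lemma time_bound_degree_mode t :
  t <= 0 -> time_bound (fun n => n%:R * mode_factor t n) 1.
Proof.
move=> t0 n; rewrite normrM normr_nat mul1r -[leRHS]mulr1.
by apply: ler_pM; [by []|by []|case: (degree_le_exp4 R n)|exact: mode_factor_le1].
Qed.

Lemma backward_dtE t : t <= 0 -> backward_dt t =
  zeta_fun (cos_series J (fun i => omega * (i.1%:R * mode_factor t i.1)) P).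
Proof.
move=> t0; apply/funext => x.
have s := time_bound_degree_mode t0.
have := seriesD omega 0 x.2 ler01 s s.
rewrite mul0r addr0 /backward_dt /zeta_fun => <-.
have -> : (fun i : nat * int => omega * (i.1%:R * mode_factor t i.1) +
    0 * (i.1%:R * mode_factor t i.1)) = fun i => omega * (i.1%:R * mode_factor t i.1).
  by apply/funext => i; rewrite mul0r addr0.
by [].
Qed.

Lemma backward_Hev t : t <= 0 -> Hev 4 (backward t).
Proof.
move=> t0; split; first exact: series_L2ev ler01 (time_bound_mode t0).
exact: le_lt_trans (series_Hnorm ler01 (time_bound_mode t0)) (ltry _).
Qed.

(** Only modes of degree at least one occur, whence the decay rate. *)
Lemma backward_decay t : t < 0 ->
  (Hnorm 4 (backward t) <= (12 * J%:R ^+ 6 * expR (omega * t))%:E)%E.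
Proof.
(* Degree [0] does not occur; the factor [0] there makes the bound below hold
   for every [n]. *)
move=> t0; pose tau n := if n is 0%N then 0 else mode_factor t n.
have tauE : backward t = zeta_fun (cos_series J (fun i => tau i.1) P).
  apply/funext => x; apply: eq_plim => N.
  apply: (eq_pairing_degree (degree_ge_picard J gamma m kappa eps N)).
  by case=> [[|n] k].
rewrite tauE; apply: series_Hnorm; first exact: expR_ge0.
case=> [|n]; first by rewrite normr0 mulr1 expR_ge0.
rewrite /tau /mode_factor ger0_norm ?expR_ge0// -[leLHS]mulr1.
apply: ler_pM; rewrite ?expR_ge0//; last by rewrite exprn_ege1// (ler_nat R 1).
rewrite ler_expR; have : omega * t <= 0 by rewrite mulr_ge0_le0// ltW.
have : 1 <= n.+1%:R :> R by rewrite (ler_nat R 1).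
by move=> h1 h2; nra.
Qed.

Lemma backward_continuous : continuous_half_line (@Hnorm R 4) backward.
Proof.
move=> t t0; pose K := 12 * J%:R ^+ 6 * omega.
apply: (@squeeze_ereal0 _ _ _ (fun s => K * `|s - t|)).
- by move=> s; exact: sqrte_ge0.
- rewrite near_withinE; apply: nearW => s /= s0.
  pose sigma n := 1 * mode_factor s n + -1 * mode_factor t n.
  have -> : backward s \- backward t =
      zeta_fun (cos_series J (fun i => sigma i.1) P).
    apply/funext => x; rewrite /zeta_fun /sigma.
    rewrite (seriesD 1 (-1) x.2 ler01 (time_bound_mode s0) (time_bound_mode t0)).
    by rewrite mul1r mulN1r.
  rewrite /K -mulrA; apply: (@series_Hnorm sigma).
    by rewrite mulr_ge0// ltW.
  move=> n; rewrite /sigma mul1r mulN1r mulrC.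
  apply: le_trans (mode_factor_lipschitz _ s0 t0) _.
  apply: ler_wpM2r; first by rewrite mulr_ge0// ltW.
  by case: (degree_le_exp4 R n).
- by apply: (@linear_bound_cvg0 _ _ t K); exact: cvg_within.
Qed.

Lemma backward_dt_continuous : continuous_half_line (@L2norm R) backward_dt.
Proof.
move=> t t0; pose K := omega * omega * (2 * pi).
apply: (@squeeze_ereal0 _ _ _ (fun s => K * `|s - t|)).
- by move=> s; exact: Lnorm_ge0.
- rewrite near_withinE; apply: nearW => s /= s0.
  pose sigma n := omega * (n%:R * mode_factor s n) +
    (- omega) * (n%:R * mode_factor t n).
  have -> : backward_dt s \- backward_dt t =
      zeta_fun (cos_series J (fun i => sigma i.1) P).
    apply/funext => x; rewrite /zeta_fun /sigma.
    rewrite (seriesD _ _ x.2 ler01 (time_bound_degree_mode s0) (time_bound_degree_mode t0)).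
    by rewrite mulNr.
  rewrite (_ : K * _ = (omega * omega * `|s - t|) * (2 * pi)); last by rewrite /K; ring.
  apply/profile_L2norm_le/(@series_profile sigma).
    by rewrite mulr_ge0// mulr_ge0// ltW.
  move=> n; rewrite (_ : sigma n = omega * n%:R * (mode_factor s n - mode_factor t n)); last by rewrite /sigma; ring.
  rewrite normrM ger0_norm; last by rewrite mulr_ge0// ltW.
  apply: le_trans (ler_wpM2l _ (mode_factor_lipschitz n s0 t0)) _.
    by rewrite mulr_ge0// ltW.
  rewrite (_ : omega * n%:R * (n%:R * (omega * `|s - t|)) =
    omega * omega * `|s - t| * n%:R ^+ 2); last by ring.
  apply: ler_wpM2l; first by rewrite mulr_ge0// mulr_ge0// ltW.
  by case: (degree_le_exp4 R n).
- by apply: (@linear_bound_cvg0 _ _ t K); exact: cvg_within.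
Qed.

Lemma backward_is_dt : is_dt backward backward_dt.
Proof.
move=> t t0; pose K := omega ^+ 2 * (2 * pi).
apply: (@squeeze_ereal0 _ _ _ (fun h => K * `|h - 0|)).
- by move=> h; exact: Lnorm_ge0.
- rewrite near_withinE /dnbhs near_withinE; apply: nearW => h h0 /= th0.
  pose rho n := h^-1 * mode_factor (t + h) n + - h^-1 * mode_factor t n.
  pose sigma n := 1 * rho n + - omega * (n%:R * mode_factor t n).
  pose B := `|h^-1| + `|h^-1| + 1.
  have B0 : 0 <= B by rewrite !addr_ge0.
  have symW tau C : C <= B -> time_bound tau C -> time_bound tau B.
    by move=> CB tC n; apply: le_trans (tC n) _; rewrite ler_wpM2r ?exprn_ge0.
  have s1 := time_bound_mode th0; have s2 := time_bound_mode t0.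
  have s3 := time_bound_degree_mode t0.
  have B1 : 1 <= B by rewrite lerDr addr_ge0.
  have srho : time_bound rho B.
    apply: (symW _ (`|h^-1| + `|h^-1|)); first by rewrite lerDl.
    move=> n; apply: le_trans (ler_normD _ _) _; rewrite mulrDl !normrM normrN.
    have := s1 n; have := s2 n; rewrite !mul1r => le2 le1.
    by apply: lerD; apply: ler_wpM2l.
  have -> : (fun x => h^-1 * (backward (t + h) x - backward t x) - backward_dt t x) =
      zeta_fun (cos_series J (fun i => sigma i.1) P).
    apply/funext => x; rewrite /zeta_fun /sigma.
    rewrite (seriesD _ _ x.2 B0 srho (symW _ _ B1 s3)) /rho.
    rewrite (seriesD _ _ x.2 ler01 s1 s2) mul1r !mulNr mulrBr.
    by [].
  rewrite subr0 (_ : K * _ = (omega ^+ 2 * `|h|) * (2 * pi)); last by rewrite /K; ring.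
  apply/profile_L2norm_le/(@series_profile sigma).
    by rewrite mulr_ge0// sqr_ge0.
  move=> n.
  have -> : sigma n = h^-1 * (mode_factor (t + h) n - mode_factor t n -
      n%:R * (omega * h) * mode_factor t n).
    by rewrite /sigma /rho; field.
  have taylor := @expR_taylor_neg R (n%:R * (omega * t)) (n%:R * (omega * h))
    (mode_exponent_le0 n t0).
  have := taylor; rewrite -!mulrDr => /(_ (mode_exponent_le0 n th0)) le2.
  rewrite normrM; apply: le_trans (ler_wpM2l _ le2) _ => //.
  have hh : `|h^-1| * h ^+ 2 = `|h|.
    by rewrite -[h ^+ 2]ger0_norm ?sqr_ge0// -normrM expr2 mulKf.
  rewrite (_ : `|h^-1| * (n%:R * (omega * h)) ^+ 2 =
    omega ^+ 2 * (`|h^-1| * h ^+ 2) * n%:R ^+ 2); last by ring.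
  rewrite hh; apply: ler_wpM2l; first by rewrite mulr_ge0// sqr_ge0.
  by case: (degree_le_exp4 R n).
- apply: (@linear_bound_cvg0 _ _ 0 K); apply: cvg_trans (cvg_within _) _; exact: cvg_within.
Qed.

Lemma backward_is_rhs t : t <= 0 ->
  is_rhs gamma m ell (backward t) (backward_dt t).
Proof.
move=> t0; apply: limit_is_rhs => //; first exact: mode_factorM.
by move=> n; exact: mode_factor_le1.
Qed.

Lemma backward_dt_L2ev t : t <= 0 -> L2ev (backward_dt t).
Proof.
move=> t0; rewrite backward_dtE//; apply: (@series_L2ev
  (fun n => omega * (n%:R * mode_factor t n)) omega); first exact: ltW.
move=> n; rewrite normrM (gtr0_norm omega0).
have := time_bound_degree_mode t0 n; rewrite mul1r => le1.
by apply: ler_wpM2l => //; exact: ltW.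
Qed.

Lemma backward_is_solution : backward_solution gamma m ell backward.
Proof.
split; [exact: backward_Hev|exact: backward_continuous|exists backward_dt].
split; [exact: backward_dt_L2ev|exact: backward_dt_continuous|
  exact: backward_is_dt|exact: backward_is_rhs].
Qed.

(** By [small_seed], all that the iteration adds to the seed is small compared
    to it. *)
Lemma backward0_near_seed y :
  `|cos_series J (fun i => mode_factor 0 i.1) P y - eps * cos (freq R J 1 * y)|
  <= eps / 4.
Proof.
have tau1 n : mode_factor 0 n = 1 by rewrite /mode_factor !mulr0 expR0.
have tau6 (i : nat * int) : `|mode_factor 0 i.1| <= 1 * weight R 6 i.
  rewrite tau1 normr1 mul1r; apply: mulr_ege1; apply: exprn_ege1.
    by rewrite (ler_nat R 1).
  by rewrite lerDl.
have cu : (fun N => cos_sum J (fun i => mode_factor 0 i.1) (P N) y) @ \oo -->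
    cos_series J (fun i => mode_factor 0 i.1) P y.
  exact: (cos_series_cvg (@weight_ge0 R 6) wP ler01 tau6).
move: cu; rewrite -cvg_shiftS => cu.
have cn : (fun N => `|cos_sum J (fun i => mode_factor 0 i.1) (P N.+1) y -
    eps * cos (freq R J 1 * y)|) @ \oo -->
    `|cos_series J (fun i => mode_factor 0 i.1) P y - eps * cos (freq R J 1 * y)|.
  by apply: cvg_norm; apply: cvgB => //; exact: cvg_cst.
rewrite -(cvg_lim (@Rhausdorff R) cn); apply: limr_le.
  by apply/cvg_ex; eexists; exact: cn.
apply: nearW => N; rewrite /cos_sum [P N.+1]/= pairing_cat.
have -> : pairing (fun i => mode_factor 0 i.1 * cos (freq R J i.2 * y)) (seed eps) =
    eps * cos (freq R J 1 * y).
  by rewrite /pairing big_seq1 /= tau1 mul1r.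
rewrite addrAC subrr add0r; apply: le_trans (small_correction N).
apply: le_pairing => i; have := cos_term_le J y tau6 i.
by rewrite mul1r.
Qed.

Lemma integral_cos_sqr n : n != 0 ->
  Rintegral mu setT (fun x => cos (phase 0 n x) * cos (phase 0 n x)) = 2 * pi ^+ 2.
Proof.
move=> n0.
have bc k : torus_bounded (fun x : R * R => cos (phase 0 k x)).
  exact/continuous_torus_bounded/continuous_cos_phase.
rewrite (_ : (fun x => _) = fun x => 2^-1 + 2^-1 * cos (phase 0 (n + n) x)).
  rewrite RintegralD//; first last.
  - by apply/torus_bounded_integrable/torus_boundedM => //; exact: torus_bounded_cst.
  - exact/torus_bounded_integrable/torus_bounded_cst.
  rewrite RintegralZl//; last exact: torus_bounded_integrable.
  rewrite (character_integral _ _).1 ?mulr0 ?addr0; last first.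
    by rewrite -mulr2n mulrn_eq0.
  by rewrite Rintegral_cst//= torus_measureT /=; field.
apply/funext => x.
have -> : phase 0 (n + n) x = phase 0 n x + phase 0 n x by rewrite /phase intrD; ring.
have := cos2Dsin2 (phase 0 n x); rewrite cosD => /eqP.
by rewrite eq_sym -subr_eq => /eqP cs; rewrite -!expr2 -cs; field.
Qed.

(** The overlap with $\cos(J \zeta)$ is that of the seed, up to an error which
    is too small to cancel it. *)
Lemma backward_nontrivial : nontrivial backward.
Proof.
exists 0 => // u0.
set u := cos_series J (fun i => mode_factor 0 i.1) P.
have pu := series_profile ler01 (time_bound_mode (lexx 0)).
pose g y := eps * cos (freq R J 1 * y).
have pg : profile eps g.
  split=> [y||y].
  - by rewrite /g cos_freq_periodic.
  - apply: continuous_measurable_fun => y; apply: cvgM; first exact: cvg_cst.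
    apply: continuous_comp; last exact: continuous_cos.
    by apply: cvgM; [exact: cvg_cst|exact: cvg_id].
  - by rewrite normrM (gtr0_norm eps0) ler_piMr ?(ltW eps0)// cos_max.
pose phi (x : R * R) := cos (phase 0 J x).
have bphi : torus_bounded phi.
  exact/continuous_torus_bounded/continuous_cos_phase.
have E := RintegralB_profile pu pg bphi.
have int_u : Rintegral mu setT (fun x => zeta_fun u x * phi x) = 0.
  rewrite /Rintegral (ae_eq_integral (cst 0%E)) ?integral0//.
  - apply/measurable_EFinP/measurable_funM; first exact: profile_measurable pu.
    by case: bphi.
  - have [A [mA A0 sA]] := u0; exists A; split => // x /= nx; apply: sA => ux.
    by apply: nx => _; rewrite /= -[zeta_fun u x]/(backward 0 x) ux mul0r.
have int_g : Rintegral mu setT (fun x => zeta_fun g x * phi x) = eps * (2 * pi ^+ 2).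
  rewrite -(@integral_cos_sqr J)// -RintegralZl//; last first.
    exact/torus_bounded_integrable/torus_boundedM.
  congr Rintegral; apply/funext => x; rewrite /zeta_fun /g /phi freq_phase mulr1.
  by rewrite mulrA.
have : `|Rintegral mu setT (fun x => zeta_fun (fun y => u y - g y) x * phi x)|
    <= eps / 4 * (4 * pi ^+ 2).
  apply: le_torus_Rintegral => [|x _].
    apply: measurable_funM; last by case: bphi.
    apply: measurable_funB; first exact: profile_measurable pu.
    exact: profile_measurable pg.
  rewrite normrM -[leRHS]mulr1; apply: ler_pM => //; last exact: cos_max.
  exact: backward0_near_seed.
rewrite E int_u int_g sub0r normrN.
have pi2 : 0 < pi ^+ 2 :> R by rewrite exprn_gt0// pi_gt0.
have h := mulr_gt0 eps0 pi2.
have p0 : 0 < eps * (2 * pi ^+ 2) by lra.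
by rewrite (gtr0_norm p0) => le; lra.
Qed.

End backward.

Theorem proposition5p3 (R : realType) (gamma m ell : R)
    (gamma_gt0 : 0 < gamma) (m_gt0 : 0 < m) (ell_gt_pi : pi < ell) :
  exists C omega : R,
    [/\ 0 < C, 0 < omega &
      exists u : R -> R * R -> R,
        [/\ backward_solution gamma m ell u,
            nontrivial u &
            forall t : R, t < 0 ->
              (Hnorm 4 (u t) <= (C * expR (omega * t))%:E)%E]].
Proof.
have ell0 : 0 < ell by apply: lt_trans ell_gt_pi; exact: pi_gt0.
have kappa0 : 0 < pi / ell by rewrite divr_gt0// pi_gt0.
have kappa1 : pi / ell < 1 by rewrite ltr_pdivrMr// mul1r.
have [J [J0 Jlt Jge]] := exists_single_unstable_mode kappa0 kappa1.
have J1 : 0 < J%:R :> R by rewrite ltr0n lt0n.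
pose nu := (pi / ell * J%:R) ^+ 2.
have nu_ge : 1 <= 4 * nu.
  rewrite (_ : 4 * nu = (2 * (J%:R * (pi / ell))) ^+ 2); last by rewrite /nu; ring.
  by rewrite exprn_ege1.
have nu_lt1 : nu < 1.
  by rewrite /nu mulrC expr_lt1// mulr_ge0// ltW.
have [eps eps0 small] := small_seed gamma_gt0 m_gt0 kappa0 nu_ge nu_lt1.
exists (12 * J%:R ^+ 6), (growth_rate (gamma * m ^+ 3) nu 1); split.
- by rewrite mulr_gt0// exprn_gt0.
- by apply: growth_rate1_gt0 => //; rewrite mulr_gt0// exprn_gt0.
have s1 N := (small N).1; have s2 N := (small N).2.
exists (backward J gamma m ell eps); split.
- exact: backward_is_solution.
- exact: backward_nontrivial.
- by move=> t t0; exact: backward_decay.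
Qed.
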